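(* Let $K$ be a field, $R=K[x_1,\dots,x_n]$, $\mathfrak{m}=(x_1,\dots,x_n)$, and let $I\subset R$ be a polymatroidal ideal of degree $3$ which is full-supported and satisfies $\gcd(I)=1$. If $\mathfrak{m}\notin\operatorname{Ass}^{\infty}(I)$, then $\operatorname{astab}(I)=\operatorname{dstab}(I)$.
   Context: For a monomial ideal $I$ of $R=K[x_1,\dots,x_n]$, $G(I)$ denotes its unique minimal set of monomial generators. $I$ is full-supported if every variable $x_1,\dots,x_n$ divides some element of $G(I)$; $\gcd(I)$ is the greatest common divisor of the elements of $G(I)$. A monomial ideal $I$ is polymatroidal of degree $d$ if it is generated by monomials of the single degree $d$ and for any $u,v\in G(I)$ and any $i$ with $\deg_{x_i}(u)>\deg_{x_i}(v)$ there is $j$ with $\deg_{x_j}(u)<\deg_{x_j}(v)$ and $x_j(u/x_i)\in I$. $\operatorname{Ass}(J)$ denotes the set of associated primes of $R/J$. By Brodmann, $\operatorname{Ass}(I^t)$ and $\operatorname{depth} R/I^t$ are constant for large $t$. $\operatorname{astab}(I)$ is the smallest integer $t_0\ge 1$ with $\operatorname{Ass}(I^t)=\operatorname{Ass}(I^{t_0})$ for all $t\ge t_0$; the stable set $\operatorname{Ass}(I^{t_0})$ is denoted $\operatorname{Ass}^{\infty}(I)$. $\operatorname{dstab}(I)$ is the smallest integer $t_0\ge 1$ with $\operatorname{depth} R/I^t=\operatorname{depth} R/I^{t_0}$ for all $t\ge t_0$. *)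

(* Defs.v *)
From HB Require Import structures.
From mathcomp Require Import all_boot all_order all_algebra.
From mathcomp Require Import mpoly.
From mathcomp Require Import boolp classical_sets.
Set Implicit Arguments.
Unset Strict Implicit.
Unset Printing Implicit Defensive.
Import GRing.Theory.
Local Open Scope classical_set_scope.
Local Open Scope ring_scope.

(* Ideals are [set R], so that equality of ideals (and of sets of ideals) is
   Leibniz equality, by set extensionality. *)

Section Indices.

(* Both default to 0 when no such integer exists. *)
Definition least (P : set nat) : nat :=
  xget 0%N [set t | P t /\ forall s, P s -> (t <= s)%N].

Definition greatest (P : set nat) : nat :=
  xget 0%N [set t | P t /\ forall s, P s -> (s <= t)%N].

Definition stab_index (T : Type) (a : nat -> T) : nat :=
  least [set t0 | (1 <= t0)%N /\ forall t, (t0 <= t)%N -> a t = a t0].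

End Indices.

Section Ideals.
Variable R : comNzRingType.
Implicit Types (I J P S : set R) (s : seq R).

Definition is_ideal J : Prop :=
  [/\ J 0, forall x y, J x -> J y -> J (x + y) & forall a x, J x -> J (a * x)].

Definition ideal_gen S : set R :=
  [set x | exists2 l : seq (R * R),
     forall p, p \in l -> S p.2 & x = \sum_(p <- l) p.1 * p.2].

Lemma ideal_gen_is_ideal S : is_ideal (ideal_gen S).
Proof.
split=> [|_ _ [k kS ->] [l lS ->]|a _ [l lS ->]].
- by exists [::]; rewrite ?big_nil.
- exists (k ++ l); last by rewrite big_cat.
  by move=> p; rewrite mem_cat => /orP[/kS|/lS].
- exists [seq (a * p.1, p.2) | p <- l]; first by move=> p /mapP[q /lS ? ->].
  by rewrite big_map mulr_sumr; apply: eq_bigr => p _; rewrite mulrA.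
Qed.

Lemma sub_ideal_gen S : S `<=` ideal_gen S.
Proof.
move=> x Sx; exists [:: (1, x)]; last by rewrite big_seq1 mul1r.
by move=> p; rewrite inE => /eqP ->.
Qed.

Lemma ideal_gen_sub S J : is_ideal J -> S `<=` J -> ideal_gen S `<=` J.
Proof.
move=> [J0 JD JM] SJ _ [l lS ->]; rewrite big_seq.
by apply: big_ind => // p /lS /SJ; apply: JM.
Qed.

(* The zeroth power is the unit ideal. *)
Definition ideal_pow I (t : nat) : set R :=
  ideal_gen [set x | exists2 f : 'I_t -> R,
     forall i, I (f i) & x = \prod_(i < t) f i].

Definition prime_ideal P : Prop :=
  [/\ is_ideal P, ~ P 1 & forall x y, P (x * y) -> P x \/ P y].

(* Ass(R/J): the primes of the form (J : f), the annihilator of f mod J. *)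
Definition Ass J : set (set R) :=
  [set P | prime_ideal P /\ exists f, P = [set x | J (x * f)]].

Fixpoint weakly_regular J s : Prop :=
  if s is f :: s' then
    (forall g, J (f * g) -> J g) /\ weakly_regular (ideal_gen (J `|` [set f])) s'
  else True.

(* s is an (R/J)-regular sequence; the second clause says R/(J + (s)) <> 0. *)
Definition regular_seq J s : Prop :=
  weakly_regular J s /\ ~ ideal_gen (J `|` [set` s]) 1.

(* depth of R/J with respect to the ideal M *)
Definition depth (M J : set R) : nat :=
  greatest [set d | exists s,
    [/\ forall f, f \in s -> M f, regular_seq J s & size s = d]].

End Ideals.

Section MonomialIdeals.
Variables (K : fieldType) (n : nat).
Local Notation R := {mpoly K[n]}.
Implicit Types (I J : set R) (A : set 'X_{1..n}) (m u v g h : 'X_{1..n}).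

Definition monomial_gen A : set R := ideal_gen [set 'X_[m] | m in A].

Definition max_ideal : set R := ideal_gen [set f | exists i : 'I_n, f = 'X_i].

(* G(I), for a monomial ideal I, as the set of exponents of the monomials of I
   that are minimal for divisibility; see [mingens_gen] and [mingens_least]. *)
Definition mingens I : set 'X_{1..n} :=
  [set m | I 'X_[m] /\ forall m', I 'X_[m'] -> (m' <= m)%MM -> m' = m].

Definition is_mgcd A g : Prop :=
  (forall u, A u -> (g <= u)%MM) /\
  (forall h, (forall u, A u -> (h <= u)%MM) -> (h <= g)%MM).

Definition full_supported I : Prop :=
  forall i : 'I_n, exists2 m, mingens I m & (0 < m i)%N.

Definition polymatroidal (d : nat) I : Prop :=
  (exists2 A, I = monomial_gen A & forall m, A m -> mdeg m = d) /\
  (forall u v, mingens I u -> mingens I v ->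
     forall i : 'I_n, (v i < u i)%N ->
     exists2 j : 'I_n, (u j < v j)%N & I 'X_[u - U_(i) + U_(j)]).

Definition astab I : nat := stab_index (fun t => Ass (ideal_pow I t)).

Definition Ass_infty I : set (set R) := Ass (ideal_pow I (astab I)).

Definition dstab I : nat :=
  stab_index (fun t => depth max_ideal (ideal_pow I t)).

Lemma monomial_gen_dvd A m : monomial_gen A 'X_[m] ->
  exists2 m', A m' & (m' <= m)%MM.
Proof.
case=> l lA /(congr1 (mcoeff m)); rewrite mcoeffX eqxx raddf_sum /= => E.
apply: contrapT => no; have := oner_neq0 K.
rewrite [X in X != _]E big_seq big1 ?eqxx // => p /lA [m' Am' <-].
apply/eqP; rewrite mcoeff_eq0; apply/negP.
rewrite (perm_mem (msuppMX _ _)) => /mapP[k _ mE].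
by apply: no; exists m'; rewrite ?mE ?lem_addr.
Qed.

Lemma monomial_gen_mingens A m : A m ->
  exists2 m', mingens (monomial_gen A) m' & (m' <= m)%MM.
Proof.
have [d] := ubnP (mdeg m); elim: d m => // d IHd m le_md Am.
have Im : monomial_gen A 'X_[m] by apply: sub_ideal_gen; exists m.
have [mmin|] := pselect (mingens (monomial_gen A) m);
  first by exists m; rewrite ?lepm_refl.
move=> /not_andP[//|/existsNP[m' /not_implyP[Im' /not_implyP[le_m'm ne]]]].
have [m2 Am2 le_m2m'] := monomial_gen_dvd Im'.
have le_m2m := lepm_trans le_m2m' le_m'm.
have ltm2 : (mdeg m2 < d)%N.
  rewrite -ltnS (leq_trans _ le_md) // ltnS.
  rewrite -(submK le_m2m) mdegD -[X in (X < _)%N]add0n ltn_add2r lt0n mdeg_eq0.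
  apply/eqP => z; apply: ne; apply/mnmP => i; apply/eqP; rewrite eqn_leq.
  move/mnm_lepP: le_m'm => -> /=.
  by rewrite -(submK le_m2m) z add0m; move/mnm_lepP: le_m2m' => ->.
have [m3 Gm3 le3] := IHd _ ltm2 Am2.
by exists m3 => //; apply: lepm_trans le3 le_m2m.
Qed.

Lemma mingens_gen A :
  monomial_gen (mingens (monomial_gen A)) = monomial_gen A.
Proof.
apply/seteqP; split; apply: ideal_gen_sub; try exact: ideal_gen_is_ideal.
  by move=> _ [m [Im _] <-].
move=> _ [m /monomial_gen_mingens[m' Gm' /submK <-] <-]; rewrite mpolyXD.
have [_ _ IM] := ideal_gen_is_ideal
  [set ('X_[m0] : R) | m0 in mingens (monomial_gen A)].
by apply: IM; apply: sub_ideal_gen; exists m'.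
Qed.

Lemma mingens_least A : mingens (monomial_gen A) `<=` A.
Proof.
move=> m [/monomial_gen_dvd[m' Am' le_m'm] mmin].
by rewrite -(mmin m') //; apply: sub_ideal_gen; exists m'.
Qed.

End MonomialIdeals.

Arguments max_ideal : clear implicits.

(* Main.v *)
Require Import Defs.
From HB Require Import structures.
From mathcomp Require Import all_boot all_order all_algebra.
From mathcomp Require Import mpoly.
From mathcomp Require Import boolp classical_sets.
From mathcomp Require Import zify ring.
Set Implicit Arguments.
Unset Strict Implicit.
Unset Printing Implicit Defensive.
Import Order.TTheory GRing.Theory.
Local Open Scope classical_set_scope.
Local Open Scope ring_scope.

(* Let B be the set of exponents of the minimal generators. For a set A of
   variables, consider the exchanges inside A between the generators of least
   degree in A. If they connect A, then a product of generators along paths from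
   i to all other vertices, divided by x_i, shows that P_A is associated to all
   large powers; if not, then the localization at P_A is a product in disjoint
   sets of variables, and P_A is associated to no power. Hence Ass(I^t) is
   eventually constant, and if the maximal ideal is not in the stable set, then
   the variables split into T and its complement such that I = P_T J, where J is
   generated by the x_i x_j over the edges of a graph (with loops) in which
   non-adjacency is transitive.

   Then Ass(I^t) consists of P_T, of the primes P_N(i) of the neighbourhoods,
   and of P_(~T) exactly when J^t has a socle. If the graph has a loop this
   happens for all t; with a triangle but no loop it happens exactly for t >= 2;
   otherwise the graph is complete bipartite and it never happens.

   If J^t has a socle then depth R/I^t = 1. Otherwise J^t is the intersection of
   the P_N(i)^t (for t = 1, or in the bipartite case), and the sum of the
   variables outside T followed by x_a - x_b is a regular sequence. Upper bounds
   for the depth come from explicit cocycles in the Koszul complex. *)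

(** * Indices, regular sequences and Koszul cocycles *)

Section Indices.

Lemma leastP (P : set nat) t : P t -> (forall s, P s -> (t <= s)%N) ->
  least P = t.
Proof.
move=> Pt tmin; rewrite /least; apply: xget_subset1; first by split.
move=> x y [Px xmin] [Py ymin]; apply/eqP.
by rewrite eqn_leq xmin // ymin.
Qed.

Lemma greatestP (P : set nat) t : P t -> (forall s, P s -> (s <= t)%N) ->
  greatest P = t.
Proof.
move=> Pt tmax; rewrite /greatest; apply: xget_subset1; first by split.
move=> x y [Px xmax] [Py ymax]; apply/eqP.
by rewrite eqn_leq xmax // ymax.
Qed.

(** [greatest] falls back to 0 when no maximum exists, so a positive value is a true maximum. *)
Lemma greatest_max (P : set nat) s : (0 < greatest P)%N -> P s ->
  (s <= greatest P)%N.
Proof.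
by rewrite /greatest; case: xgetP => [t -> [_ tmax] _ /tmax|] //; rewrite ltnn.
Qed.

Lemma stab_index_eq1 (T : Type) (a : nat -> T) :
  (forall t, (1 <= t)%N -> a t = a 1%N) -> stab_index a = 1%N.
Proof. by move=> aE; apply: leastP => // s []. Qed.

Lemma stab_index_eq2 (T : Type) (a : nat -> T) :
  (forall t, (2 <= t)%N -> a t = a 2%N) -> a 1%N <> a 2%N ->
  stab_index a = 2%N.
Proof.
move=> aE ne; apply: leastP => // -[|[|s]] [] // _ aE1.
by case: ne; rewrite aE1.
Qed.

Lemma stab_indexE (T : Type) (a : nat -> T) t0 : (1 <= t0)%N ->
  (forall t, (t0 <= t)%N -> a t = a t0) ->
  forall t, (t0 <= t)%N -> a (stab_index a) = a t.
Proof.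
move=> t0_gt0 aE t le_t0t.
pose Q := fun s => `[< (1 <= s)%N /\ forall t, (s <= t)%N -> a t = a s >].
have exQ : exists s, Q s by exists t0; apply/asboolP.
case: (ex_minnP exQ) => s /asboolP[s_gt0 sE] smin.
have -> : stab_index a = s by apply: leastP => // r ?; apply/smin/asboolP.
by rewrite sE // (leq_trans _ le_t0t) // smin //; apply/asboolP.
Qed.

End Indices.

Section Ideals.
Variable R : comNzRingType.
Implicit Types (J A B S : set R) (f g h u v x y : R).

Definition regular_mod f J : Prop := forall g, J (f * g) -> J g.

Lemma idealN J : is_ideal J -> forall x, J x -> J (- x).
Proof. by move=> [_ _ JM] x /(JM (-1)); rewrite mulN1r. Qed.

Lemma idealB J : is_ideal J -> forall x y, J x -> J y -> J (x - y).
Proof. by move=> iJ x y Jx /(idealN iJ); case: iJ => _ JD _; apply: JD. Qed.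

Lemma ideal_sum J : is_ideal J -> forall (T : Type) (r : seq T) (P : pred T)
  (F : T -> R), (forall i, P i -> J (F i)) -> J (\sum_(i <- r | P i) F i).
Proof. by move=> [J0 JD _] T r P F JF; apply: big_ind. Qed.

Lemma ideal_genU1P J f x : is_ideal J ->
  ideal_gen (J `|` [set f]) x <-> exists2 j, J j & exists u, x = j + f * u.
Proof.
move=> iJ; have [J0 JD JM] := iJ; split.
  have iL : is_ideal [set x | exists2 j, J j & exists u, x = j + f * u].
    split.
    - by exists 0 => //; exists 0; rewrite mulr0 addr0.
    - move=> _ _ [j Jj [u ->]] [k Jk [v ->]].
      by exists (j + k); [apply: JD | exists (u + v); ring].
    - move=> a _ [j Jj [u ->]].
      by exists (a * j); [apply: JM | exists (a * u); ring].
  apply: (ideal_gen_sub iL) => y [Jy|->]; last first.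
    by exists 0 => //; exists 1; rewrite mulr1 add0r.
  by exists y => //; exists 0; rewrite mulr0 addr0.
move=> [j Jj [u ->]].
have [_ LD LM] := ideal_gen_is_ideal (J `|` [set f]).
apply: LD; first by apply: sub_ideal_gen; left.
by rewrite mulrC; apply: LM; apply: sub_ideal_gen; right.
Qed.

Lemma ideal_genU_gen S f : ideal_gen (ideal_gen S `|` [set f]) =
  ideal_gen (S `|` [set f]).
Proof.
have iL := ideal_gen_is_ideal (S `|` [set f]).
apply/seteqP; split; [apply: (ideal_gen_sub iL)|];
  last apply: (ideal_gen_sub (ideal_gen_is_ideal _)).
  move=> x [|->]; last by apply: sub_ideal_gen; right.
  by apply: (ideal_gen_sub iL) => y Sy; apply: sub_ideal_gen; left.
move=> x [Sx|->]; apply: sub_ideal_gen; last by right.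
by left; apply: sub_ideal_gen.
Qed.

Lemma regular_modI f A B :
  regular_mod f A -> regular_mod f B -> regular_mod f (A `&` B).
Proof. by move=> fA fB g [/fA Ag /fB Bg]. Qed.

(* The hypothesis says that [f] is regular modulo [A + B]. *)
Lemma ideal_genI A B f : is_ideal A -> is_ideal B ->
  (forall u a b, A a -> B b -> f * u = a + b ->
     exists2 a', A a' & B (u - a')) ->
  ideal_gen (A `|` [set f]) `&` ideal_gen (B `|` [set f]) `<=`
  ideal_gen (A `&` B `|` [set f]).
Proof.
move=> iA iB f_reg x [/ideal_genU1P-/(_ iA)[a Aa [u xE]]].
move=> /ideal_genU1P-/(_ iB)[b Bb [v xE']].
have [_ AD AM] := iA; have [_ BD BM] := iB.
have [|a' Aa' Ba'] := f_reg (u - v) (- a) b (idealN iA Aa) Bb.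
  by rewrite mulrBr -[f * u](addKr a) -xE xE'; ring.
apply/ideal_genU1P.
  split; first by case: iA iB => ? _ _ [].
    by move=> ? ? [? ?] [? ?]; split; [apply: AD | apply: BD].
  by move=> ? ? [? ?]; split; [apply: AM | apply: BM].
exists (x - f * (u - a')); last by exists (u - a'); rewrite subrK.
split.
  have -> : x - f * (u - a') = a + f * a' by rewrite xE; ring.
  by apply: AD => //; apply: AM.
have -> : x - f * (u - a') = b - f * (u - v - a') by rewrite xE'; ring.
by apply: idealB => //; apply: BM.
Qed.

End Ideals.

(** * Koszul cohomology as an upper bound for the length of regular sequences *)

Section Koszul.
Variables (R : comNzRingType) (n : nat) (x : 'I_n -> R).
Implicit Types (J : set R).

Let M := ideal_gen [set f | exists i, f = x i].

(* [koszul q J] says that the [q]-th cohomology of the Koszul complex of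
   [x] with coefficients in [R/J], i.e. essentially Ext^q(R/M, R/J), is nonzero. *)
Definition koszul0 J := exists2 v, ~ J v & forall i, J (x i * v).

Definition koszul1 J := exists2 w : 'I_n -> R,
  forall i j, J (x i * w j - x j * w i) &
  ~ exists v, forall i, J (w i - x i * v).

Definition koszul2 J := exists2 w : 'I_n -> 'I_n -> R,
  forall i j k, J (x i * w j k - x j * w i k + x k * w i j) &
  ~ exists v : 'I_n -> R, forall i j, J (w i j - (x i * v j - x j * v i)).

Lemma mem_lincomb f : M f -> exists a : 'I_n -> R, f = \sum_i a i * x i.
Proof.
have iL : is_ideal [set f | exists a : 'I_n -> R, f = \sum_i a i * x i].
  split.
  - by exists (fun=> 0); rewrite big1 // => i _; rewrite mul0r.
  - move=> _ _ [a ->] [b ->]; exists (fun i => a i + b i).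
    by rewrite -big_split; apply: eq_bigr => i _; rewrite mulrDl.
  - move=> c _ [a ->]; exists (fun i => c * a i).
    by rewrite mulr_sumr; apply: eq_bigr => i _; rewrite mulrA.
apply: (ideal_gen_sub iL) => _ [i ->]; exists (fun j => (j == i)%:R).
rewrite (bigD1 i) //= eqxx mul1r big1 ?addr0 // => j /negPf ->.
by rewrite mul0r.
Qed.

Lemma koszul0_irregular J f : is_ideal J -> M f -> koszul0 J ->
  ~ regular_mod f J.
Proof.
move=> iJ /mem_lincomb[a ->] [v nJv Jxv] f_reg; apply: nJv; apply: f_reg.
rewrite mulr_suml; apply: ideal_sum => // i _; rewrite -mulrA.
by case: iJ => _ _; apply.
Qed.

(** Contract the cocycle with the coefficients of $f=\sum a_ix_i$ to $v=\sum a_iw_i$. The cocycle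
    condition gives $x_jv\equiv fw_j$ modulo $J$; a relation $v\equiv fu$ would make $w$ the
    coboundary of $u$, because $f$ is regular. *)
Lemma koszul1_quot J f : is_ideal J -> M f -> regular_mod f J ->
  koszul1 J -> koszul0 (ideal_gen (J `|` [set f])).
Proof.
move=> iJ /mem_lincomb[a fE] f_reg [w wZ wB]; have [_ JD JM] := iJ.
have key j : J (x j * (\sum_i a i * w i) - f * w j).
  rewrite fE mulr_sumr mulr_suml -sumrB; apply: ideal_sum => // i _.
  have -> : x j * (a i * w i) - a i * x i * w j
            = a i * (x j * w i - x i * w j) by ring.
  exact/JM/wZ.
exists (\sum_i a i * w i) => [|i].
  move=> /ideal_genU1P-/(_ iJ)[j Jj [u vE]]; apply: wB; exists u => i.
  apply: f_reg; have -> : f * (w i - x i * u) =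
    x i * j - (x i * (\sum_i a i * w i) - f * w i) by rewrite vE; ring.
  by apply: idealB => //; apply: JM.
apply/ideal_genU1P => //.
by exists (x i * (\sum_i a i * w i) - f * w i) => //; exists (w i); rewrite subrK.
Qed.

(** The same contraction one degree higher: if it were $x_ic+fu_i$ modulo $J$, then $w$ would be the
    coboundary of $u$. *)
Lemma koszul2_quot J f : is_ideal J -> M f -> regular_mod f J ->
  koszul2 J -> koszul1 (ideal_gen (J `|` [set f])).
Proof.
move=> iJ /mem_lincomb[a fE] f_reg [w wZ wB]; have [_ JD JM] := iJ.
pose v j := \sum_i a i * w i j.
have key j k : J (x k * v j - x j * v k + f * w j k).
  rewrite fE !mulr_sumr mulr_suml -sumrB -big_split; apply: ideal_sum => //= i _.
  have -> : x k * (a i * w i j) - x j * (a i * w i k) + a i * x i * w j k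
            = a i * (x i * w j k - x j * w i k + x k * w i j) by ring.
  exact/JM/wZ.
exists v => [j k|].
  apply/ideal_genU1P => //; exists (x j * v k - x k * v j + f * w k j) => //.
  by exists (- w k j); ring.
move=> [c cE]; apply: wB.
have {}cE i : exists u, J (v i - x i * c - f * u).
  have /ideal_genU1P-/(_ iJ)[j Jj [u E]] := cE i.
  by exists u; rewrite E addrK.
have [u uE] := choice cE.
exists u => j k; apply: f_reg.
have -> : f * (w j k - (x j * u k - x k * u j)) =
  (x k * v j - x j * v k + f * w j k) - x k * (v j - x j * c - f * u j)
  + x j * (v k - x k * c - f * u k) by ring.
apply: JD; last exact: JM.
by apply: idealB => //; apply: JM.
Qed.

(** The first element of a longer sequence moves the class to degree 0, where no element of [M] is
    regular. *)
Lemma regular_seq_le1 J s : is_ideal J -> koszul1 J ->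
  (forall f, f \in s -> M f) -> regular_seq J s -> (size s <= 1)%N.
Proof.
case: s => [|f [|g s]] // iJ kJ sM [[f_reg [g_reg _]] _].
have Mf : M f by apply: sM; rewrite mem_head.
have Mg : M g by apply: sM; rewrite !inE eqxx orbT.
case: (@koszul0_irregular _ g (ideal_gen_is_ideal (J `|` [set f]))) => //.
exact: koszul1_quot.
Qed.

Lemma regular_seq_le2 J s : is_ideal J -> koszul2 J ->
  (forall f, f \in s -> M f) -> regular_seq J s -> (size s <= 2)%N.
Proof.
case: s => [|f s] // iJ kJ sM [[f_reg s_reg] s_ne].
have Mf : M f by apply: sM; rewrite mem_head.
apply: (@regular_seq_le1 (ideal_gen (J `|` [set f]))).
- exact: ideal_gen_is_ideal.
- exact: koszul2_quot.
- by move=> g gs; apply: sM; rewrite inE gs orbT.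
(* Properness passes to the tail [s], as $(J+(f))+(s)$ is contained in $J+(f,s)$. *)
split=> // E; apply: s_ne; move: E; apply: ideal_gen_sub.
  exact: ideal_gen_is_ideal.
move=> y [|/= ys]; last by apply: sub_ideal_gen; right; rewrite /= inE ys orbT.
apply: ideal_gen_sub; first exact: ideal_gen_is_ideal.
move=> z [Jz|->]; apply: sub_ideal_gen; [by left|right].
by rewrite /= mem_head.
Qed.

End Koszul.

(** * Monomial ideals and their associated primes *)

Section MonomialIdeals.
Variables (K : fieldType) (n : nat).
Local Notation R := {mpoly K[n]}.
Implicit Types (W V : set 'X_{1..n}) (m : 'X_{1..n}) (p q h : R).

(** Given by supports instead of generators, so that membership and intersections are tested
    exponent by exponent; an ideal once [W] is up-closed. *)
Definition mon_ideal W : set R := [set p | forall m, m \in msupp p -> W m].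

Definition up_closed W : Prop := forall m m', W m -> W (m + m')%MM.

Lemma up_closed_le W m m' : up_closed W -> W m -> (m <= m')%MM -> W m'.
Proof. by move=> Wup Wm /submK <-; rewrite addmC; apply: Wup. Qed.

Lemma up_closedU W V : up_closed W -> up_closed V -> up_closed (W `|` V).
Proof. by move=> Wup Vup m m' [Wm|Vm]; [left; apply: Wup | right; apply: Vup]. Qed.

Lemma mon_ideal_ideal W : up_closed W -> is_ideal (mon_ideal W).
Proof.
move=> Wup; split.
- by move=> m; rewrite msupp0.
- by move=> p q Wp Wq m /msuppD_le; rewrite mem_cat => /orP[/Wp|/Wq].
- move=> a p Wp m /msuppM_le /allpairsP[[m1 m2] /= [_ m2p ->]].
  by rewrite addmC; apply/Wup/Wp.
Qed.

Lemma mon_idealX W m : mon_ideal W 'X_[m] <-> W m.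
Proof. by split=> [|Wm k]; [apply; rewrite msuppX mem_head | move/mem_msuppXP <-]. Qed.

Lemma mon_idealI W V : mon_ideal (W `&` V) = mon_ideal W `&` mon_ideal V.
Proof.
apply/seteqP; split=> p; first by move=> WVp; split=> m /WVp[].
by move=> [Wp Vp] m mp; split; [apply: Wp | apply: Vp].
Qed.

Lemma mon_ideal_gen W : up_closed W ->
  mon_ideal W = ideal_gen [set 'X_[m] | m in W].
Proof.
move=> Wup; apply/seteqP; split=> [p Wp|].
  rewrite (mpolyE p) big_seq; have iL := ideal_gen_is_ideal [set ('X_[m] : R) | m in W].
  apply: (ideal_sum iL) => m /Wp Wm; rewrite -mul_mpolyC.
  by case: iL => _ _; apply; apply: sub_ideal_gen; exists m.
apply: (ideal_gen_sub (mon_ideal_ideal Wup)) => _ [m Wm <-].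
exact/mon_idealX.
Qed.

Definition multiples W : set 'X_{1..n} := [set m | exists2 k, W k & (k <= m)%MM].

Lemma multiples_up W : up_closed (multiples W).
Proof. by move=> m m' [k Wk le_km]; exists k => //; apply: lepm_trans (lem_addr _ _). Qed.

Lemma monomial_genE W : @monomial_gen K n W = mon_ideal (multiples W).
Proof.
rewrite (mon_ideal_gen (@multiples_up W)); have iL (S : set R) := ideal_gen_is_ideal S.
apply/seteqP; split; apply: (ideal_gen_sub (iL _)).
  by move=> _ [m Wm <-]; apply: sub_ideal_gen; exists m => //; exists m; rewrite ?lepm_refl.
move=> _ [m [k Wk /submK <-] <-]; rewrite mpolyXD.
have [_ _ LM] := iL [set ('X_[m0] : R) | m0 in W].
by apply: LM; apply: sub_ideal_gen; exists k.
Qed.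

Lemma mon_ideal_split W p :
  exists q r, [/\ p = q + r, mon_ideal W q & mon_ideal (~` W) r].
Proof.
pose q := \sum_(m <- msupp p | `[< W m >]) p@_m *: 'X_[m] : R.
pose r := \sum_(m <- msupp p | ~~ `[< W m >]) p@_m *: 'X_[m] : R.
exists q, r; split.
- by rewrite [LHS]mpolyE (bigID (fun m => `[< W m >])).
- move=> m; rewrite /q => /msupp_sum_le/flattenP[s /mapP[k kp ->]].
  move/msuppZ_le/mem_msuppXP => <-; move: kp; rewrite mem_filter.
  by case/andP => /asboolP.
- move=> m; rewrite /r => /msupp_sum_le/flattenP[s /mapP[k kp ->]].
move/msuppZ_le/mem_msuppXP => <-; move: kp; rewrite mem_filter.
by case/andP => /asboolPn.
Qed.

Lemma mon_idealP W p : mon_ideal W p <-> forall m, ~ W m -> p@_m = 0.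
Proof.
split=> [Wp m nWm|Wp m]; first by apply: memN_msupp_eq0; apply/negP => /Wp.
by rewrite mcoeff_msupp => /eqP nz; apply: contrapT => /Wp.
Qed.

Lemma mon_idealU W V p : mon_ideal (W `|` V) p ->
  exists2 q, mon_ideal W q & mon_ideal V (p - q).
Proof.
move=> WVp; have [q [r [pE Wq Wr]]] := mon_ideal_split W p.
exists q => //; rewrite pE addrC addKr => m mr.
have nWm := Wr m mr.
have := WVp m; rewrite pE mcoeff_msupp mcoeffD.
have /mon_idealP-> // := Wq; rewrite add0r -mcoeff_msupp => /(_ mr).
by case.
Qed.

(** Modulo the ideal both factors may be taken supported outside [W]; the leading exponent of their
    product is then a sum of two exponents outside [W]. *)
Lemma mon_ideal_prime W : up_closed W -> ~ W 0%MM ->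
  (forall m m', W (m + m')%MM -> W m \/ W m') -> prime_ideal (mon_ideal W).
Proof.
move=> Wup W0 Wpr; have iW := mon_ideal_ideal Wup; split=> //.
  by move=> /(_ 0%MM); rewrite msupp1 mem_head => /(_ isT).
move=> p q; have [p1 [p2 [-> Wp1 Wp2]]] := mon_ideal_split W p.
have [q1 [q2 [-> Wq1 Wq2]]] := mon_ideal_split W q => Wpq.
have [_ WD WM] := iW.
have {}Wpq : mon_ideal W (p2 * q2).
  have -> : p2 * q2 = (p1 + p2) * (q1 + q2) - ((q1 + q2) * p1 + p2 * q1) by ring.
  by apply: (idealB iW) => //; apply: WD; apply: WM.
have [->|p2n0] := eqVneq p2 0; first by left; rewrite addr0.
have [->|q2n0] := eqVneq q2 0; first by right; rewrite addr0.
have /Wpr[] : W (mlead p2 + mlead q2)%MM.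
- by rewrite -mleadM //; apply: (Wpq (mlead _)); rewrite mlead_supp // mulf_neq0.
- by move/Wp2 : (mlead_supp p2n0).
- by move/Wq2 : (mlead_supp q2n0).
Qed.

Definition hits (A : {set 'I_n}) : set 'X_{1..n} :=
  [set m | exists2 i, i \in A & (0 < m i)%N].

Lemma hits_up A : up_closed (hits A).
Proof. by move=> m m' [i iA mi]; exists i => //; rewrite mnmDE ltn_addr. Qed.

Lemma hits1 A i : hits A U_(i)%MM <-> i \in A.
Proof.
split=> [[j jA]|iA]; last by exists i; rewrite // mnm1E eqxx.
by rewrite mnm1E; case: eqP => // ->.
Qed.

Lemma hits_mon_inj A A' : mon_ideal (hits A) = mon_ideal (hits A') -> A = A'.
Proof.
move=> E; apply/setP => i; apply/idP/idP => /hits1/mon_idealX;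
  [rewrite E | rewrite -E]; by move/mon_idealX/hits1.
Qed.

Lemma hits_prime A : prime_ideal (mon_ideal (hits A)).
Proof.
apply: mon_ideal_prime; first exact: hits_up.
  by move=> [i _]; rewrite mnm0E.
move=> m m' [i iA]; rewrite mnmDE addn_gt0 => /orP[mi|mi]; [left|right];
  by exists i.
Qed.

(* [mon_ass W A] says that the prime generated by the variables in [A] is a
   colon ideal [(W : x^f)]. *)
Definition mon_ass W (A : {set 'I_n}) : Prop :=
  exists f, forall m, W (f + m)%MM <-> hits A m.

Lemma mon_ideal_mulX W f p : mon_ideal W (p * 'X_[f]) <->
  mon_ideal [set m | W (f + m)%MM] p.
Proof.
split=> Wp m.
  by move=> mp; apply: Wp; rewrite (perm_mem (msuppMX _ _)) map_f.
by rewrite (perm_mem (msuppMX _ _)) => /mapP[k /Wp /= Wk ->].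
Qed.

(* Multiplying [h] by the leading monomial of an element [p] of the prime
   [(W : h)] kills the leading term of [h]; if that monomial were not in the
   prime, this would give a colon presentation with fewer terms. *)
Lemma colon_lead_mem W P h p : up_closed W -> prime_ideal P ->
  P = [set g | mon_ideal W (g * h)] ->
  (forall h', P = [set g | mon_ideal W (g * h')] ->
     (size (msupp h) <= size (msupp h'))%N) ->
  P p -> p != 0 -> P 'X_[mlead p].
Proof.
move=> Wup [iP nP1 Ppr] PE hmin Pp pn0; apply: contrapT => nP.
have iW := mon_ideal_ideal Wup; have [_ WD WM] := iW.
have hn0 : h != 0.
  by apply/eqP => h0; apply: nP1; rewrite PE /= h0 mulr0; case: iW.
have [q [r [E Wq Wr]]] := mon_ideal_split W ('X_[mlead p] * h).
have PE' : P = [set g | mon_ideal W (g * r)].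
  have rE : r = 'X_[mlead p] * h - q by rewrite E addrC addKr.
  apply/seteqP; split=> g.
    move=> Pg; have : mon_ideal W (g * h) by move: Pg; rewrite {1}PE.
    move=> Wgh; rewrite /= rE mulrBr mulrCA; apply: (idealB iW) => //; exact: WM.
  move=> /= Wgr; have : P (g * 'X_[mlead p]).
    by rewrite PE /= -mulrA E mulrDr; apply: WD => //; apply: WM.
  by case/Ppr.
have hmax m : m \in msupp r -> m \in [seq (mlead p + k)%MM | k <- msupp h].
  move=> mr; have : m \in msupp ('X_[mlead p] * h).
    rewrite E mcoeff_msupp mcoeffD; have /mon_idealP-> := Wq; last exact: Wr.
    by rewrite add0r -mcoeff_msupp.
  by rewrite mulrC (perm_mem (msuppMX _ _)).
suff : (size (msupp r) < size (msupp h))%N by rewrite ltnNge hmin.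
rewrite -(size_map (fun k => mlead p + k)%MM (msupp h)).
(* This exponent leads [p * h], which lies in the ideal, so it belongs to [W] and is missing from
   [r]. *)
have lead_in : (mlead p + mlead h)%MM \in [seq (mlead p + k)%MM | k <- msupp h].
  by apply: map_f; apply: mlead_supp.
rewrite (perm_size (perm_to_rem lead_in)) /= ltnS; apply: uniq_leq_size => // m mr.
rewrite rem_filter; last first.
  by rewrite map_inj_uniq ?msupp_uniq //; apply: addmI.
rewrite mem_filter hmax // andbT; apply/eqP => mE; apply: (Wr m mr).
have := Pp; rewrite {1}PE /= mE; apply.
by rewrite -mleadM // mlead_supp // mulf_neq0.
Qed.

(** In a presentation of [P] as a colon by an [h] with fewest terms, leading monomials of elements
    of [P] lie in [P], so [P] is spanned by monomials. Primality then lets a single term of [h]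
    replace [h]. *)
Lemma AssP W P : up_closed W ->
  Ass (mon_ideal W) P <-> exists2 A, P = mon_ideal (hits A) & mon_ass W A.
Proof.
move=> Wup; split=> [|[A -> [f fE]]]; last first.
  split; first exact: hits_prime.
  exists 'X_[f]; apply/seteqP; split=> p /=; rewrite mon_ideal_mulX;
    by move=> Wp m /Wp /fE.
have iW := mon_ideal_ideal Wup; have [W0 WD WM] := iW.
move=> [Ppr exh]; have [iP nP1 Pmul] := Ppr.
pose Q k := `[< exists2 h, P = [set g | mon_ideal W (g * h)] & size (msupp h) = k >].
have exQ : exists k, Q k.
  by have [h ?] := exh; exists (size (msupp h)); apply/asboolP; exists h.
case: (ex_minnP exQ) => k /asboolP[h PE hk] kmin.
have hmin h' : P = [set g | mon_ideal W (g * h')] ->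
    (size (msupp h) <= size (msupp h'))%N.
  by move=> E; rewrite hk; apply: kmin; apply/asboolP; exists h'.
have Pmon p : P p -> forall m, m \in msupp p -> P 'X_[m].
  have [k' lt] := ubnP (size (msupp p)).
  elim: k' p lt => // k' IH p lt Pp m mp.
  have pn0 : p != 0 by apply/eqP => p0; move: mp; rewrite p0 msupp0.
  have Pl := colon_lead_mem Wup Ppr PE hmin Pp pn0.
  have [->//|ne] := eqVneq m (mlead p).
  have [_ _ PMl] := iP.
  apply: (IH (p - p@_(mlead p) *: 'X_[mlead p])).
  - rewrite (perm_size (msupp_rem _ _)) size_rem ?mlead_supp //.
    by case: (msupp p) mp lt.
  - by apply: (idealB iP) => //; rewrite -mul_mpolyC; apply: PMl.
  - by rewrite (perm_mem (msupp_rem _ _)) rem_filter ?msupp_uniq // mem_filter /= ne.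
have Psum p : (forall m, m \in msupp p -> P 'X_[m]) -> P p.
  move=> Pm; rewrite (mpolyE p) big_seq; apply: (ideal_sum iP) => m /Pm.
  by rewrite -mul_mpolyC; case: iP => _ _; apply.
have [f fh PEf] : exists2 f, f \in msupp h & forall m, P 'X_[m] <-> W (f + m)%MM.
  have cov m : P 'X_[m] -> forall f, f \in msupp h -> W (f + m)%MM.
    rewrite PE /= mulrC => /mon_ideal_mulX Wm f fh.
    by rewrite addmC; apply: Wm.
  (* Otherwise each term [f] of [h] has a multiplier [b f] outside [P] that carries it into [W]; the
     product of all of them kills [h], hence lies in the prime [P]. *)
  have [f fh fE] : exists2 f, f \in msupp h & forall m, W (f + m)%MM -> P 'X_[m].
    apply: contrapT => no.
    have {no} bad f : f \in msupp h -> exists m, W (f + m)%MM /\ ~ P 'X_[m].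
      move=> fh; apply: contrapT => no'; apply: no; exists f => // m Wm.
      by apply: contrapT => nP; apply: no'; exists m.
    have /choice[b bE] f : exists m, f \in msupp h -> W (f + m)%MM /\ ~ P 'X_[m].
      case: (boolP (f \in msupp h)) => [/bad[m ?]|_]; first by exists m.
      by exists 0%MM.
    pose M := (\sum_(f <- msupp h) b f)%MM.
    have : P 'X_[M].
      rewrite PE /= mulrC; apply/mon_ideal_mulX => f fh /=.
      have [Wf _] := bE f fh; apply: (up_closed_le Wup Wf).
      apply/mnm_lepP => i; rewrite !mnmDE addnC leq_add2r; move: i; apply/mnm_lepP.
      rewrite /M (perm_big _ (perm_to_rem fh)) big_cons.
      exact: lem_addr.
    rewrite /M (big_morph (fun m => 'X_[m] : R) (@mpolyXD _ _) (@mpolyX0 _ _)) big_seq.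
    by apply: (big_ind (fun p => ~ P p)) => // [p q nP nQ /Pmul[]//|f /bE[]].
  by exists f => // m; split=> [/cov|/fE//]; apply.
have PmonE m : P 'X_[m] <-> exists2 i, P 'X_i & (0 < m i)%N.
  split=> [|[i Pi mi]].
    rewrite mpolyXE_id => Pm; apply: contrapT => no; move: Pm.
    apply: (big_ind (fun p => ~ P p)) => // [p q nP nQ /Pmul[]//|i _].
    case mi: (m i) => [|e]; first by rewrite expr0.
    have nPi : ~ P 'X_i by move=> Pi; apply: no; exists i; rewrite ?mi.
    by elim: e.+1 => [|e' IH]; rewrite ?expr0 // exprS => /Pmul[].
  have -> : m = (m - U_(i) + U_(i))%MM.
    by rewrite submK //; apply/mnm_lepP => j; rewrite mnm1E; case: eqP => [<-|].
  by rewrite mpolyXD; case: iP => _ _; apply.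
pose A := [set i | `[< P 'X_i >]]%SET.
have hitsE m : hits A m <-> P 'X_[m].
  rewrite PmonE; split=> -[i]; first by rewrite inE => /asboolP; exists i.
  by move=> Pi mi; exists i => //; rewrite inE; apply/asboolP.
exists A; last by exists f => m; rewrite hitsE PEf.
apply/seteqP; split=> p; first by move=> Pp m mp; apply/hitsE/Pmon/mp.
by move=> Am; apply: Psum => m /Am /hitsE.
Qed.

Lemma max_idealE : max_ideal K n = mon_ideal (hits [set: 'I_n]).
Proof.
rewrite (mon_ideal_gen (@hits_up _)); apply/seteqP; split;
  apply: (ideal_gen_sub (ideal_gen_is_ideal _)).
  move=> _ [i ->]; apply: sub_ideal_gen; exists U_(i)%MM => //.
  by apply/hits1; rewrite inE.
move=> _ [m [i _ mi] <-].
have -> : m = (m - U_(i) + U_(i))%MM.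
  by rewrite submK //; apply/mnm_lepP => j; rewrite mnm1E; case: eqP => [<-|].
rewrite mpolyXD; have [_ _ LM] := ideal_gen_is_ideal [set f : R | exists i, f = 'X_i].
by apply: LM; apply: sub_ideal_gen; exists i.
Qed.

End MonomialIdeals.

(** * Regular elements from substitutions *)

Section Substitution.
Variables (K : fieldType) (n : nat) (i : 'I_n) (w : {mpoly K[n]}).
Local Notation R := {mpoly K[n]}.
Implicit Types (W : set 'X_{1..n}) (S : set R) (p q g h : R).

Definition substX : R -> R :=
  comp_mpoly [tuple (if j == i then w else 'X_j) | j < n].

HB.instance Definition _ := GRing.RMorphism.copy substX
  (comp_mpoly [tuple (if j == i then w else 'X_j : R) | j < n]).

Lemma substX_monomial (m : 'X_{1..n}) : m i = 0%N -> substX 'X_[m] = 'X_[m].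
Proof.
move=> mi; rewrite /substX comp_mpolyX [RHS]mpolyXE_id.
apply: eq_bigr => j _; rewrite tnth_mktuple.
by have [->|//] := eqVneq j i; rewrite mi !expr0.
Qed.

Lemma substXi : substX 'X_i = w.
Proof. by rewrite /substX comp_mpolyXU -tnth_nth tnth_mktuple eqxx. Qed.

Lemma substXj j : j != i -> substX 'X_j = 'X_j.
Proof. by move=> ne; apply: substX_monomial; rewrite mnm1E (negPf ne). Qed.

Lemma substX_sub p : exists q, p = substX p + ('X_i - w) * q.
Proof.
pose P p := exists q, p = substX p + ('X_i - w) * q.
have PM p1 p2 : P p1 -> P p2 -> P (p1 * p2).
  move=> [q1 E1] [q2 E2]; rewrite /P rmorphM /=.
  exists (q1 * p2 + substX p1 * q2).
  by rewrite {1}E1 mulrDl {1}E2; ring.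
have PX m : P 'X_[m].
  rewrite mpolyXE_id; apply: (big_ind P) => //.
    by exists 0; rewrite rmorph1 mulr0 addr0.
  move=> j _; elim: (m j) => [|e IH].
    by exists 0; rewrite expr0 rmorph1 mulr0 addr0.
  rewrite exprS; apply: PM => //; have [->|ne] := eqVneq j i.
    by exists 1; rewrite substXi; ring.
  by exists 0; rewrite substXj // mulr0 addr0.
apply: (mpolyind (P := P)); first by exists 0; rewrite rmorph0 mulr0 addr0.
move=> c m q _ _ [q2 E2]; have [q1 E1] := PX m.
exists (c%:MP * q1 + q2); rewrite rmorphD /= -mul_mpolyC rmorphM /=.
have -> : substX c%:MP = c%:MP by rewrite /substX comp_mpolyC.
by rewrite {1}E1 {1}E2; ring.
Qed.

Hypothesis w_fixed : substX w = w.
Hypothesis w_ne : 'X_i - w != 0.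

Lemma substX_gen S j : (forall s, S s -> substX s = s) ->
  ideal_gen S j -> ideal_gen S (substX j).
Proof.
move=> Sfix [l lS ->]; rewrite rmorph_sum /= big_seq.
apply: ideal_sum; first exact: ideal_gen_is_ideal.
move=> p /lS Sp; rewrite rmorphM /= (Sfix _ Sp).
have [_ _ LM] := ideal_gen_is_ideal S.
by apply/LM/sub_ideal_gen.
Qed.

(** Each coefficient is its substitution plus a multiple of ['X_i - w]. In a relation for
    [('X_i - w) * g] the substituted coefficients contribute zero, and ['X_i - w] cancels from the
    rest. *)
Lemma regular_substX S : (forall s, S s -> substX s = s) ->
  regular_mod ('X_i - w) (ideal_gen S).
Proof.
move=> Sfix g [l lS E].
have [a aE] := choice substX_sub.
exists [seq (a r.1, r.2) | r <- l].
  by move=> _ /mapP[p /lS ? ->].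
apply: (mulfI w_ne); have E0 : \sum_(r <- l) substX r.1 * r.2 = 0.
  have /(congr1 substX) := E; rewrite rmorphM rmorphB /= substXi w_fixed subrr mul0r.
  rewrite rmorph_sum /= => E0; rewrite [RHS]E0; apply: eq_big_seq => r /lS Sr.
  by rewrite rmorphM /= (Sfix _ Sr).
transitivity (\sum_(r <- l) r.1 * r.2 - \sum_(r <- l) substX r.1 * r.2).
  by rewrite E0 subr0.
rewrite -sumrB big_map mulr_sumr; apply: eq_bigr => r _.
by rewrite {1}(aE r.1) /=; ring.
Qed.

(* For up-closed [W]: membership does not depend on the exponent of [x_i]. *)
Definition insensitive W : Prop :=
  forall m, W m -> exists m', [/\ W m', m' i = 0%N & (m' <= m)%MM].

Lemma insensitive_gen W : up_closed W -> insensitive W ->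
  mon_ideal W = ideal_gen [set ('X_[m] : R) | m in [set m | W m /\ m i = 0%N]].
Proof.
move=> Wup Wi; apply: etrans (esym (monomial_genE K _)); congr (mon_ideal _).
apply/seteqP; split=> m.
  by move=> /Wi[m' [Wm' m'i le]]; exists m'.
by move=> [m' [Wm' m'i] le]; apply: up_closed_le Wm' le.
Qed.

Lemma regular_mon_ideal W : up_closed W -> insensitive W ->
  regular_mod ('X_i - w) (mon_ideal W).
Proof.
move=> Wup Wi; rewrite insensitive_gen //; apply: regular_substX.
by move=> _ [m [_ mi] <-]; apply: substX_monomial.
Qed.

Lemma regular_mon_idealU W f : up_closed W -> insensitive W -> substX f = f ->
  regular_mod ('X_i - w) (ideal_gen (mon_ideal W `|` [set f])).
Proof.
move=> Wup Wi ffix; rewrite insensitive_gen // ideal_genU_gen.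
apply: regular_substX => s [[m [_ mi] <-]|->//]; exact: substX_monomial.
Qed.

(** Modulo ['X_i - w] an element equals its substitution, and substitution preserves an ideal
    generated by monomials free of ['X_i]; so the question moves back to [mon_ideal W]. *)
Lemma regular_mon_ideal_quot W g : up_closed W -> insensitive W ->
  regular_mod (substX g) (mon_ideal W) ->
  regular_mod g (ideal_gen (mon_ideal W `|` [set 'X_i - w])).
Proof.
move=> Wup Wi g_reg h; have iW := mon_ideal_ideal K Wup.
move=> /ideal_genU1P-/(_ iW)[j Wj [u E]].
have [q hE] := substX_sub h; apply/ideal_genU1P => //.
exists (substX h); last by exists q.
apply: g_reg; rewrite -rmorphM /= E rmorphD rmorphM rmorphB /= substXi w_fixed.
rewrite subrr mul0r addr0; move: Wj; rewrite insensitive_gen //.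
apply: substX_gen => _ [m [_ mi] <-]; exact: substX_monomial.
Qed.

End Substitution.

(** * Powers of polymatroidal ideals *)

Section Sums.
Variable n : nat.
Implicit Types (B : set 'X_{1..n}) (u v w m h : 'X_{1..n}) (A T : {set 'I_n}).

Fixpoint sums B (t : nat) : set 'X_{1..n} :=
  if t is t'.+1 then
    [set m | exists u v, [/\ B u, sums B t' v & m = (u + v)%MM]]
  else [set 0%MM].

Lemma sums1 B u : B u -> sums B 1 u.
Proof. by move=> Bu; exists u, 0%MM; rewrite addm0. Qed.

Lemma sumsD B s t m m' : sums B s m -> sums B t m' -> sums B (s + t) (m + m')%MM.
Proof.
elim: s m => [|s IH] m; first by move=> ->; rewrite add0m.
move=> [u [v [Bu sv ->]]] sm'; exists u, (v + m')%MM; split=> //; first exact: IH.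
by rewrite addmA.
Qed.

Lemma sums_muln B t u : B u -> sums B t (u *+ t)%MM.
Proof.
move=> Bu; elim: t => [|t IH]; first by rewrite mulm0n.
by exists u, (u *+ t)%MM; rewrite mulmS.
Qed.

Lemma sums_sub B B' t : B `<=` B' -> sums B t `<=` sums B' t.
Proof.
move=> sub; elim: t => [|t IH] //= m [u [v [Bu sv ->]]].
by exists u, v; split; [apply: sub | apply: IH |].
Qed.

Definition degin A m : nat := (\sum_(i in A) m i)%N.

Lemma deginD A m m' : degin A (m + m')%MM = (degin A m + degin A m')%N.
Proof. by rewrite /degin -big_split; apply: eq_bigr => i _; rewrite mnmDE. Qed.

Lemma degin1 A i : degin A U_(i)%MM = (i \in A).
Proof.
rewrite /degin; have [iA|iA] := boolP (i \in A).
  rewrite (bigD1 i) //= mnm1E eqxx big1 // => j /andP[_ /negPf ne].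
  by rewrite mnm1E eq_sym ne.
by rewrite big1 // => j jA; rewrite mnm1E; case: eqP => // E; rewrite E jA in iA.
Qed.

Lemma degin_le A m m' : (forall i, i \in A -> m i <= m' i)%N ->
  (degin A m <= degin A m')%N.
Proof. by move=> le; apply: leq_sum. Qed.

Lemma degin_eq0 A m : degin A m = 0%N -> forall i, i \in A -> m i = 0%N.
Proof. by move=> /eqP; rewrite sum_nat_eq0 => /forall_inP m0 i /m0/eqP. Qed.

Lemma deginT m : degin [set: 'I_n] m = mdeg m.
Proof. by rewrite mdegE /degin; apply: eq_bigl => i; rewrite inE. Qed.

Lemma degin_setC A m : (degin A m + degin (~: A) m)%N = mdeg m.
Proof.
rewrite mdegE (bigID (mem A)) /=; congr addn.
by apply: eq_bigl => i; rewrite inE.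
Qed.

Lemma degin_notin A m : (forall i, i \in A -> m i = 0%N) -> degin A m = 0%N.
Proof. by move=> m0; apply: big1. Qed.

Lemma degin_gt0P A m : (0 < degin A m)%N -> exists2 i, i \in A & (0 < m i)%N.
Proof.
rewrite lt0n => /eqP ne; apply: contrapT => no; apply: ne; apply: degin_notin.
move=> i iA; apply/eqP; rewrite -leqn0 leqNgt; apply/negP => mi.
by apply: no; exists i.
Qed.

Lemma sums_degin B t m A c : (forall u, B u -> degin A u = c) ->
  sums B t m -> degin A m = (t * c)%N.
Proof.
move=> Bc; elim: t m => [|t IH] m.
  by move=> ->; rewrite degin_notin // => i _; rewrite mnm0E.
by move=> [u [v [Bu /IH sv ->]]]; rewrite deginD sv Bc // mulSn.
Qed.

Lemma sums_degin_ge B t m A c : (forall u, B u -> (c <= degin A u)%N) ->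
  sums B t m -> (t * c <= degin A m)%N.
Proof.
move=> Bc; elim: t m => [|t IH] m; first by rewrite mul0n.
by move=> [u [v [Bu /IH sv ->]]]; rewrite deginD mulSn leq_add ?Bc.
Qed.

Definition restr A m : 'X_{1..n} := [multinom if i \in A then m i else 0%N | i < n].

Lemma restrE A m i : restr A m i = if i \in A then m i else 0%N.
Proof. by rewrite mnmE. Qed.

End Sums.

Lemma ideal_pow_monomial (K : fieldType) n (B : set 'X_{1..n}) t :
  ideal_pow (@monomial_gen K n B) t = mon_ideal (multiples (sums B t)).
Proof.
rewrite monomial_genE.
have iW t' := mon_ideal_ideal K (@multiples_up n (sums B t')).
apply/seteqP; split.
  apply: (ideal_gen_sub (iW t)) => _ [f If ->].
  elim: t f If => [|t IH] f If.
    rewrite big_ord0 -mpolyX0; apply/mon_idealX; exists 0%MM => //.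
    exact: lepm_refl.
  rewrite big_ord_recl => m /msuppM_le/allpairsP[[m1 m2] /= [m1f m2f ->]].
  have [u Bu le1] := If _ _ m1f.
  have [v sv le2] := IH _ (fun i => If (lift ord0 i)) _ m2f.
  exists (u + v)%MM; first by exists u, v.
  by apply/mnm_lepP => i; rewrite !mnmDE leq_add // ?(mnm_lepP le1) ?(mnm_lepP le2).
rewrite -monomial_genE; apply: (ideal_gen_sub (ideal_gen_is_ideal _)).
move=> _ [m sm <-]; apply: sub_ideal_gen.
suff [f Bf ->] : exists2 f : 'I_t -> 'X_{1..n}, forall i, B (f i) &
    'X_[m] = \prod_(i < t) 'X_[f i] :> {mpoly K[n]}.
  exists (fun i => 'X_[f i]) => // i; apply/mon_idealX; exists (f i) => //.
  exact: lepm_refl.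
elim: t m sm => [|t IH] m.
  by move=> ->; exists (fun=> 0%MM) => [[]//|]; rewrite big_ord0 mpolyX0.
move=> [u [v [Bu /IH[f Bf fE] ->]]].
exists (fun i => if unlift ord0 i is Some j then f j else u).
  by move=> i; case: unliftP.
rewrite big_ord_recl unlift_none mpolyXD fE; congr (_ * _).
by apply: eq_bigr => i _; rewrite liftK.
Qed.

(** * Exchange graphs and stability of the associated primes *)

Section Exchange.
Variables (n : nat) (B : set 'X_{1..n}).
Implicit Types (u v w m h : 'X_{1..n}) (A T : {set 'I_n}).

Definition exchange : Prop := forall u v, B u -> B v ->
  forall i, (v i < u i)%N ->
  exists2 j, (u j < v j)%N & B (u - U_(i) + U_(j))%MM.

Hypothesis B_exch : exchange.
Hypothesis B_ne : exists u, B u.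

Let W t := multiples (sums B t).

(* Restricted to [A], these are the generators of the localization of the
   ideal at the prime generated by the variables in [A]. *)
Definition minimal_in A : set 'X_{1..n} :=
  [set u | B u /\ forall v, B v -> (degin A u <= degin A v)%N].

Lemma minimal_in_ex A : exists u, minimal_in A u.
Proof.
pose P k := `[< exists2 u, B u & degin A u = k >].
have exP : exists k, P k by have [u Bu] := B_ne; exists (degin A u); apply/asboolP; exists u.
case: (ex_minnP exP) => k /asboolP[u Bu uk] kmin.
by exists u; split=> // v Bv; rewrite uk; apply: kmin; apply/asboolP; exists v.
Qed.

Lemma exchangeE u i j l : (0 < u i)%N ->
  ((u - U_(i) + U_(j))%MM l + (i == l) = u l + (j == l))%N.
Proof. by move=> ui; rewrite mnmDE mnmBE !mnm1E; case: eqP => [<-|_]; lia. Qed.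

Lemma degin_exchange A u i j : (0 < u i)%N ->
  (degin A (u - U_(i) + U_(j))%MM + (i \in A) = degin A u + (j \in A))%N.
Proof.
move=> ui; rewrite -!degin1 -!deginD; apply: eq_bigr => l _.
by have := exchangeE j l ui; rewrite !mnmDE !mnmBE !mnm1E.
Qed.

(** The total excess of [v] over [u] on [A] drops at each exchange: a unit leaves a coordinate where
    [v] is too large and enters one where it is too small. *)
Lemma exchange_descent A (Q : set 'X_{1..n}) u : B u -> Q `<=` B ->
  (forall v i j, Q v -> i \in A -> (0 < v i)%N ->
     B (v - U_(i) + U_(j))%MM -> Q (v - U_(i) + U_(j))%MM) ->
  forall v, Q v -> exists2 w, Q w & forall i, i \in A -> (w i <= u i)%N.
Proof.
move=> Bu QB Qex v; have [k] := ubnP (\sum_(i in A) (v i - u i))%N.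
elim: k v => // k IH v lt Qv.
have [le|] := pselect (forall i, i \in A -> (v i <= u i)%N); first by exists v.
move=> /existsNP[i /not_implyP[iA /negP]]; rewrite -ltnNge => lt_i.
have vi : (0 < v i)%N by lia.
have [j lt_j Bv'] := B_exch (QB _ Qv) Bu lt_i.
apply: (IH _ _ (Qex _ _ _ Qv iA vi Bv')).
rewrite -ltnS; apply: leq_trans lt; rewrite ltnS (bigD1 i) //= [X in (_ <= X)%N](bigD1 i) //=.
have := exchangeE j i vi; rewrite eqxx => Ei.
have ne : (j == i) = false by apply/eqP => E; rewrite E in lt_j; lia.
rewrite ne in Ei.
rewrite -addSn; apply: leq_add; first by lia.
apply: leq_sum => l /andP[_ nli]; have := exchangeE j l vi.
rewrite eq_sym (negPf nli); case: eqP => [<-|_]; lia.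
Qed.

(** The degree in [A] cannot fall below its minimum, so a variable removed from [A] is replaced by
    one in [A]. *)
Lemma minimal_in_exchange A v i j : minimal_in A v -> i \in A -> (0 < v i)%N ->
  B (v - U_(i) + U_(j))%MM -> minimal_in A (v - U_(i) + U_(j))%MM /\ j \in A.
Proof.
move=> [Bv vmin] iA vi Bv'; have E := degin_exchange A j vi.
have le := vmin _ Bv'; rewrite iA in E; split.
  by split=> // w /vmin le'; apply: leq_trans le'; lia.
by move: E; case: (j \in A) => //; lia.
Qed.

Lemma minimal_in_below A u : B u ->
  exists2 v, minimal_in A v & forall i, i \in A -> (v i <= u i)%N.
Proof.
move=> Bu; have [v mv] := minimal_in_ex A.
apply: (@exchange_descent A (minimal_in A)) mv => //; first by move=> w [].
by move=> w i j mw iA wi /(minimal_in_exchange mw iA wi)[].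
Qed.

(* [T] is a union of connected components of the linear relation graph on [A]. *)
Definition closed_in A T : Prop := forall u j k, minimal_in A u ->
  j \in T -> k \in A -> (0 < u j)%N -> B (u - U_(j) + U_(k))%MM -> k \in T.

(** Descend from [v] towards [u] by exchanges that start in [T]. They also end in [T], so the other
    coordinates in [A] keep their values. *)
Lemma closed_in_mix A T u v : T \subset A -> closed_in A T ->
  minimal_in A u -> minimal_in A v ->
  exists w, [/\ minimal_in A w, forall i, i \in T -> (w i <= u i)%N &
    forall i, i \in A -> i \notin T -> w i = v i].
Proof.
move=> TA Tcl [Bu _] mv.
pose Q w := minimal_in A w /\ forall i, i \in A -> i \notin T -> w i = v i.
have [||w [mw wv] wu] := @exchange_descent T Q u Bu _ _ v (conj mv (fun _ _ _ => erefl)).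
- by move=> w [[]].
- move=> w i j [mw wE] iT wi Bw'.
  have [mw' jA] := minimal_in_exchange mw (fintype.subsetP TA _ iT) wi Bw'.
  split=> // l lA lT; have jT := Tcl _ _ _ mw iT jA wi Bw'.
  have := exchangeE j l wi; rewrite (wE _ lA lT).
  case: eqP => [E|_]; first by rewrite -E iT in lT.
  case: eqP => [E|_]; first by rewrite -E jT in lT.
  lia.
by exists w.
Qed.

Lemma closed_in_mix_sums A T t m1 m2 : T \subset A -> closed_in A T ->
  sums B t m1 -> sums B t m2 ->
  exists m, [/\ sums B t m, forall i, i \in T -> (m i <= m1 i)%N &
    forall i, i \in A -> i \notin T -> (m i <= m2 i)%N].
Proof.
move=> TA Tcl; elim: t m1 m2 => [|t IH] m1 m2.
  by move=> -> ->; exists 0%MM; split.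
move=> [u1 [v1 [Bu1 /IH sv1 ->]]] [u2 [v2 [Bu2 /sv1[m [sm ml mr]] ->]]].
have [u1' mu1 le1] := minimal_in_below A Bu1.
have [u2' mu2 le2] := minimal_in_below A Bu2.
have [w [mw wl wr]] := closed_in_mix TA Tcl mu1 mu2.
exists (w + m)%MM; split; first by exists w, m; case: mw.
  move=> i iT; rewrite !mnmDE leq_add ?ml //.
  by apply: leq_trans (wl _ iT) (le1 _ (fintype.subsetP TA _ iT)).
by move=> i iA iT; rewrite !mnmDE leq_add ?mr // (wr _ iA iT) le2.
Qed.

(** Let [f] be a witness, [k] in [A] outside [T]. Both $x_kf$ and $x_if$ lie in the power. Mixing
    the first product on [T] with the second on the rest of [A] avoids both extra variables, so a
    multiple of [f] by variables outside [A] is in the power. *)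
Lemma disconnected_not_ass A T t i : T \subset A -> T != A -> i \in T ->
  closed_in A T -> ~ mon_ass (W t) A.
Proof.
move=> TA neq iT Tcl [f fE].
have /fintype.subsetPn[k kA kT] : ~~ (A \subset T).
  by apply: contra neq => AT; rewrite finset.eqEsubset TA.
have /fE[m1 sm1 le1] : hits A U_(k)%MM by apply/hits1.
have /fE[m2 sm2 le2] : hits A U_(i)%MM by apply/hits1/(fintype.subsetP TA).
have [m [sm ml mr]] := closed_in_mix_sums TA Tcl sm1 sm2.
have /fE[l lA] : W t (f + restr (~: A) m)%MM.
  exists m => //; apply/mnm_lepP => l; rewrite mnmDE restrE inE.
  have [lA|lA] /= := boolP (l \in A); last by rewrite leq_addl.
  have [lT|lT] := boolP (l \in T).
    apply: leq_trans (ml _ lT) _; move/mnm_lepP/(_ l): le1.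
    by rewrite mnmDE mnm1E; case: eqP => // E; rewrite -E (negPf kT) in lT.
  apply: leq_trans (mr _ lA lT) _; move/mnm_lepP/(_ l): le2.
  by rewrite mnmDE mnm1E; case: eqP => // E; rewrite -E iT in lT.
by rewrite restrE inE lA.
Qed.

(** A path of exchanges from [i] to [j], remembered only through products: $x^hx_j/x_i$ is again a
    product of [r] minimal generators. *)
Definition reach A (i j : 'I_n) : Prop := exists r h h',
  [/\ sums (minimal_in A) r h, sums (minimal_in A) r h' &
      (h' + U_(i) = h + U_(j))%MM].

Lemma reach_step A i j k u : reach A i j -> minimal_in A u -> j \in A ->
  (0 < u j)%N -> B (u - U_(j) + U_(k))%MM -> reach A i k.
Proof.
move=> [r [h [h' [sh sh' E]]]] mu jA uj Bu'.
have [mu' kA] := minimal_in_exchange mu jA uj Bu'.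
exists (1 + r)%N, (u + h)%MM, (u - U_(j) + U_(k) + h')%MM; split.
- by apply: sumsD => //; apply: sums1.
- by apply: sumsD => //; apply: sums1.
apply/mnmP => l; move/mnmP/(_ l): E; have := exchangeE k l uj.
rewrite !mnmDE !mnmBE !mnm1E; lia.
Qed.

(** Multiplying the products of all the paths gives one [h] that serves every endpoint. *)
Lemma reach_common A i (s : seq 'I_n) : (forall j, j \in s -> reach A i j) ->
  exists r h, sums (minimal_in A) r h /\
    forall j, j \in s -> exists2 h', sums (minimal_in A) r h' &
      (h' + U_(i) = h + U_(j))%MM.
Proof.
elim: s => [|j s IH] sr; first by exists 0%N, 0%MM.
have [|r [h [sh hE]]] := IH; first by move=> k ks; apply: sr; rewrite inE ks orbT.
have [r' [g [g' [sg sg' gE]]]] := sr j (mem_head _ _).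
exists (r + r')%N, (h + g)%MM; split; first exact: sumsD.
move=> k; rewrite inE => /orP[/eqP->|/hE[h' sh' E]].
  by exists (h + g')%MM; [apply: sumsD | rewrite -!addmA gE].
exists (h' + g)%MM; first exact: sumsD.
by apply/mnmP => l; move/mnmP/(_ l): E; rewrite !mnmDE !mnm1E; lia.
Qed.

(** The witness is a product of [t] minimal generators divided by $x_i$. Its degree in [A] is one
    too small, and multiplication by any $x_j$ trades $x_i$ for $x_j$ along a path. *)
Lemma connected_ass A i u : i \in A -> minimal_in A u -> (0 < u i)%N ->
  (forall j, j \in A -> reach A i j) ->
  exists t0, forall t, (t0 <= t)%N -> mon_ass (W t) A.
Proof.
move=> iA mu ui Ar; have [Bu umin] := mu.
have [|r [h [sh hE]]] := @reach_common A i (enum A).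
  by move=> j; rewrite mem_enum; apply: Ar.
exists r.+1 => t lt; have -> : t = (r + (t - r.+1).+1)%N by lia.
(* Copies of [u] pad the path product to [t] factors; at least one copy is present, so $x_i$ divides
   it. *)
move: (t - r.+1)%N => s; pose g := (h + u *+ s.+1)%MM.
have gi : (U_(i) <= g)%MM.
  apply/mnm_lepP => l; rewrite mnm1E; case: eqP => // <-.
  by rewrite /g mulmS !mnmDE; lia.
exists (g - U_(i))%MM => m; split; last first.
  move=> [j jA mj]; have [|h' sh' h'E] := hE j; first by rewrite mem_enum.
  exists (h' + u *+ s.+1)%MM.
    apply: sumsD; last exact: sums_muln.
    by apply: sums_sub sh' => ? [].
  apply/mnm_lepP => l; move/mnmP/(_ l): h'E; move/mnm_lepP/(_ l): gi.
  have : ((j == l) <= m l)%N by case: eqP => [<-|].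
  rewrite /g !mnmDE mnmBE !mnmDE !mnm1E.
  by case: (j == l); case: (i == l); lia.
move=> [w sw le]; apply: degin_gt0P.
have gdeg : degin A g = ((r + s.+1) * degin A u)%N.
  apply: (@sums_degin _ (minimal_in A)) => [v [Bv vmin]|].
    by apply/eqP; rewrite eqn_leq umin // vmin.
  by apply: sumsD => //; apply: sums_muln.
have := @sums_degin_ge _ _ _ w A _ umin sw.
have : (degin A w <= degin A (g - U_(i) + m)%MM)%N.
  by apply: degin_le => l _; apply/mnm_lepP.
have : degin A g = (degin A (g - U_(i))%MM + 1)%N.
  by rewrite -{1}(submK gi) deginD degin1 iA.
rewrite deginD -gdeg; lia.
Qed.

Lemma connected_or_closed A i u : i \in A -> minimal_in A u -> (0 < u i)%N ->
  (exists t0, forall t, (t0 <= t)%N -> mon_ass (W t) A) \/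
  exists T, [/\ T \subset A, T != A, i \in T & closed_in A T].
Proof.
move=> iA mu ui; pose T := [set j in A | `[< reach A i j >]]%SET.
have [E|ne] := eqVneq T A; [left|right].
  apply: (connected_ass iA mu ui) => j jA.
  by have : j \in T; [rewrite E | rewrite inE => /andP[_ /asboolP]].
exists T; split=> //.
- by apply/fintype.subsetP => j; rewrite !inE => /andP[].
(* The empty path reaches [i] itself. *)
- by rewrite inE iA; apply/asboolP; exists 0%N; exists 0%MM; exists 0%MM.
move=> v j k mv; rewrite !inE => /andP[jA /asboolP rj] kA vj Bv.
by rewrite kA; apply/asboolP; apply: reach_step rj mv jA vj Bv.
Qed.

Lemma mon_ass_stable A : exists t0,
  (forall t, (t0 <= t)%N -> mon_ass (W t) A) \/
  (forall t, (t0 <= t)%N -> ~ mon_ass (W t) A).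
Proof.
have [u mu] := minimal_in_ex A; have [Bu _] := mu.
have [E|] := posnP (degin A u); last first.
  case/degin_gt0P => i iA ui; have [[t0 ?]|[T [TA ne iT Tcl]]] := connected_or_closed iA mu ui.
    by exists t0; left.
  by exists 0%N; right => t _; apply: disconnected_not_ass TA ne iT Tcl.
(* Here [u] avoids [A], so the localization is the unit ideal: $x^{tu}f$ is in the power without any
   variable from [A]. *)
exists 0%N; right => t _ [f fE].
have /fE[i iA] : W t (f + u *+ t)%MM.
  by exists (u *+ t)%MM; [apply: sums_muln | apply: lem_addl].
by rewrite mulmnE (degin_eq0 E).
Qed.

Lemma mon_ass_all_stable : exists2 t0, (0 < t0)%N &
  forall t A, (t0 <= t)%N -> mon_ass (W t) A <-> mon_ass (W t0) A.
Proof.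
have [s sE] := choice mon_ass_stable.
exists (\max_A s A).+1 => // t A lt.
have le : (s A <= (\max_A s A).+1)%N by apply/leqW/leq_bigmax.
have le' := leq_trans le lt.
by case: (sE A) => aE; have := aE _ le; have := aE _ le'.
Qed.

End Exchange.

Section MoreSums.
Variable n : nat.
Implicit Types (B : set 'X_{1..n}) (u v w s m : 'X_{1..n}) (X T : {set 'I_n}).

Lemma sums_add_gen B1 B2 B3 t p q :
  (forall u v, B1 u -> B2 v -> B3 (u + v)%MM) ->
  sums B1 t p -> sums B2 t q -> sums B3 t (p + q)%MM.
Proof.
move=> BD; elim: t p q => [|t IH] p q; first by move=> -> ->; rewrite addm0.
move=> [u [p' [Bu sp ->]]] [v [q' [Bv sq ->]]].
exists (u + v)%MM, (p' + q')%MM; split; [exact: BD | exact: IH |].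
by apply/mnmP => i; rewrite !mnmDE; lia.
Qed.

Definition vars X : set 'X_{1..n} := [set m | exists2 i, i \in X & m = U_(i)%MM].

Lemma sums_vars_out X t p i : sums (vars X) t p -> i \notin X -> p i = 0%N.
Proof.
elim: t p => [|t IH] p; first by move=> ->; rewrite mnm0E.
move=> [_ [v [[k kX ->] /IH sv ->]]] iX; rewrite mnmDE sv // mnm1E addn0.
by case: eqP => // E; rewrite -E kX in iX.
Qed.

Lemma degin_vars X t m : (t <= degin X m)%N ->
  exists2 p, sums (vars X) t p & (p <= m)%MM.
Proof.
elim: t m => [|t IH] m lt.
  by exists 0%MM => //; apply/mnm_lepP => i; rewrite mnm0E.
have [i iX mi] : exists2 i, i \in X & (0 < m i)%N by apply: degin_gt0P; lia.
have le : (U_(i) <= m)%MM.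
  by apply/mnm_lepP => l; rewrite mnm1E; case: eqP => // <-.
have [|p sp lep] := IH (m - U_(i))%MM.
  by move: lt; rewrite -{1}(submK le) deginD degin1 iX; lia.
exists (U_(i) + p)%MM; first by exists U_(i)%MM, p; split=> //; exists i.
by rewrite -(submK le) addmC; apply/mnm_lepP => l; rewrite !mnmDE leq_add2r;
  apply: (mnm_lepP lep).
Qed.

Lemma degin_muln X m k : degin X (m *+ k)%MM = (degin X m * k)%N.
Proof.
elim: k => [|k IH]; last by rewrite mulmS deginD IH mulnS.
by rewrite mulm0n muln0 degin_notin // => i _; rewrite mnm0E.
Qed.

Lemma up_closed_degin X t : up_closed [set m | (t <= degin X m)%N].
Proof. by move=> m m' /= le; rewrite deginD (leq_trans le) // leq_addr. Qed.

Lemma degin_drop X i m : i \notin X -> degin X (restr (~: [set i]) m) = degin X m.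
Proof.
move=> iX; apply: eq_bigr => j jX; rewrite restrE !inE.
by case: eqP => // E; rewrite -E jX in iX.
Qed.

Lemma restr_le X m : (restr X m <= m)%MM.
Proof. by apply/mnm_lepP => i; rewrite restrE; case: ifP. Qed.

Lemma restr_drop i m : restr (~: [set i]) m i = 0%N.
Proof. by rewrite restrE !inE eqxx. Qed.

Lemma mnm_shuffle u v w s : (u + (v + w) + s = u + w + s + v :> 'X_{1..n})%MM.
Proof. by apply/mnmP => x; rewrite !mnmDE; lia. Qed.

End MoreSums.

(** * Separated polymatroids of degree 3 *)

Section Separators.
Variables (n d : nat) (B : set 'X_{1..n}).
Hypothesis B_deg : forall u, B u -> mdeg u = d.

(** The generators form a product: their parts inside and outside [T] can be chosen
    independently. *)
Definition separator (T : {set 'I_n}) : Prop := forall u v, B u -> B v ->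
  exists w, [/\ B w, forall i, i \in T -> w i = u i & forall i, i \notin T -> w i = v i].

Lemma separatorC T : separator T -> separator (~: T).
Proof.
move=> sep u v Bu Bv; have [w [Bw wv wu]] := sep v u Bv Bu.
by exists w; split=> // i; rewrite inE ?negbK; [apply: wu | apply: wv].
Qed.

(** The mixture of [u] and [v] has the same total degree as [v] and agrees with it outside [T]. *)
Lemma separator_degin T u v : separator T -> B u -> B v -> degin T u = degin T v.
Proof.
move=> sep Bu Bv; have [w [Bw wu wv]] := sep u v Bu Bv.
have Ew : degin T w = degin T u by apply: eq_bigr => i /wu.
have Ev : degin (~: T) w = degin (~: T) v.
  by apply: eq_bigr => i; rewrite inE => /wv.
have := degin_setC T w; have := degin_setC T v; rewrite !B_deg //; lia.
Qed.

Lemma minimal_in_setT : minimal_in B [set: 'I_n] = B.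
Proof.
apply/seteqP; split=> u; first by case.
by move=> Bu; split=> // v Bv; rewrite !deginT !B_deg.
Qed.

(** Mixing gives only an inequality on [T]. Applied in both directions it makes the degree in [T]
    constant, which forces equality in each coordinate. *)
Lemma closed_in_separator T : exchange B -> closed_in B [set: 'I_n] T ->
  separator T.
Proof.
move=> Bex Tcl.
have mix u v : B u -> B v -> exists w, [/\ B w, forall i, i \in T -> (w i <= u i)%N
    & forall i, i \notin T -> w i = v i].
  move=> Bu Bv; have [|||w] := @closed_in_mix _ _ Bex [set: 'I_n] T u v _ Tcl.
  - exact: finset.subsetT.
  - by rewrite minimal_in_setT.
  - by rewrite minimal_in_setT.
  rewrite minimal_in_setT => -[Bw wu wv]; exists w; split=> // i; apply: wv.
  by rewrite inE.
have le u v : B u -> B v -> (degin T v <= degin T u)%N.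
  move=> Bu Bv; have [w [Bw wu wv]] := mix u v Bu Bv.
  have Ew : (degin T w <= degin T u)%N by apply: degin_le.
  have Ev : degin (~: T) w = degin (~: T) v.
    by apply: eq_bigr => i; rewrite inE => /wv.
  have := degin_setC T w; have := degin_setC T v; rewrite !B_deg //; lia.
move=> u v Bu Bv; have [w [Bw wu wv]] := mix u v Bu Bv.
exists w; split=> // i iT; apply/eqP; rewrite eqn_leq wu //=.
have := le w u Bw Bu; rewrite /degin (bigD1 i) //= [X in (_ <= X)%N](bigD1 i) //=.
have : (\sum_(j in T | j != i) w j <= \sum_(j in T | j != i) u j)%N.
  by apply: leq_sum => j /andP[/wu].
move: (\sum_(j in T | j != i) w j)%N (\sum_(j in T | j != i) u j)%N; lia.
Qed.

End Separators.

Section Edges.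
Variables (n : nat) (B : set 'X_{1..n}) (T : {set 'I_n}).
Hypothesis B_exch : exchange B.
Hypothesis B_deg : forall u, B u -> mdeg u = 3%N.
Hypothesis B_full : forall i, exists2 u, B u & (0 < u i)%N.
Hypothesis B_sep : separator B T.
Hypothesis B_T : forall u, B u -> degin T u = 1%N.

Definition edge (i j : 'I_n) : bool :=
  [&& i \notin T, j \notin T &
      `[< forall a, a \in T -> B (U_(a) + U_(i) + U_(j))%MM >]].

Lemma edge_sym i j : edge i j = edge j i.
Proof.
rewrite /edge andbCA; congr (_ && (_ && _)); apply/asboolP/asboolP => H a aT;
  by have := H a aT; rewrite -addmA [(U_(_) + U_(_))%MM]addmC addmA.
Qed.

Lemma edgeP i j a : edge i j -> a \in T ->
  [/\ i \notin T, j \notin T & B (U_(a) + U_(i) + U_(j))%MM].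
Proof. by case/and3P => iT jT /asboolP H aT; split=> //; apply: H. Qed.

Lemma mdeg2E (m : 'X_{1..n}) : mdeg m = 2%N ->
  exists i j, m = (U_(i) + U_(j))%MM.
Proof.
move=> m2; have [i _ mi] : exists2 i, i \in [set: 'I_n]%SET & (0 < m i)%N.
  by apply: degin_gt0P; rewrite deginT m2.
have le : (U_(i) <= m)%MM.
  by apply/mnm_lepP => l; rewrite mnm1E; case: eqP => // <-.
have : mdeg (m - U_(i))%MM == 1%N.
  by move: m2; rewrite -{1}(submK le) mdegD mdeg1; lia.
case/mdeg1P => j /eqP E; exists j, i; by rewrite -E submK.
Qed.

(** One [a] suffices: by separation the part in [T] can be replaced by that of a generator divisible
    by $x_b$, which is $x_b$ alone since the degree in [T] is one. *)
Lemma edge_intro a i j : a \in T -> i \notin T -> j \notin T ->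
  B (U_(a) + U_(i) + U_(j))%MM -> edge i j.
Proof.
move=> aT iT jT Bu; apply/and3P; split=> //; apply/asboolP => b bT.
have [v Bv vb] := B_full b; have [w [Bw wv wu]] := B_sep Bv Bu.
suff <- : w = (U_(b) + U_(i) + U_(j))%MM by [].
have vT l : l \in T -> v l = (b == l).
  move=> lT; have := B_T Bv; rewrite /degin (bigD1 b) //=.
  have [<-|ne] := eqVneq b l; first by lia.
  by rewrite (bigD1 l) /= ?lT ?(eq_sym l) //; lia.
have neT l k : l \in T -> k \notin T -> (l == k) = false.
  by move=> lT kT; apply/eqP => E; rewrite -E lT in kT.
apply/mnmP => l; rewrite !mnmDE !mnm1E; have [lT|lT] := boolP (l \in T).
  by rewrite wv // vT // (eq_sym i) (eq_sym j) (neT l i) // (neT l j) // !addn0.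
by rewrite wu // !mnmDE !mnm1E (neT a l) // (neT b l).
Qed.

Lemma edge_gen u : B u -> exists a i j,
  [/\ a \in T, edge i j & u = (U_(a) + U_(i) + U_(j))%MM].
Proof.
move=> Bu; have [a aT ua] : exists2 a, a \in T & (0 < u a)%N.
  by apply: degin_gt0P; rewrite B_T.
have le : (U_(a) <= u)%MM.
  by apply/mnm_lepP => l; rewrite mnm1E; case: eqP => // <-.
have [|i [j E]] := @mdeg2E (u - U_(a))%MM.
  by have := B_deg Bu; rewrite -{1}(submK le) mdegD mdeg1; lia.
have uE : u = (U_(a) + U_(i) + U_(j))%MM.
  by rewrite -(submK le) E addmC addmA.
have := B_T Bu; rewrite uE !deginD !degin1 aT => dT.
exists a, i, j; split=> //; apply: edge_intro aT _ _ _; last by rewrite -uE.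
  by move: dT; case: (i \in T) => //; lia.
by move: dT; case: (j \in T) => //; lia.
Qed.

Lemma edge_total i : i \notin T -> exists j, edge i j.
Proof.
move=> iT; have [u Bu ui] := B_full i.
have [a [k [l [aT kl uE]]]] := edge_gen Bu.
move: ui; rewrite uE !mnmDE !mnm1E; case: (a =P i) => [E|_].
  by rewrite -E aT in iT.
have [<-|_] := k =P i; first by exists l.
by have [<-|//] := l =P i; exists k; rewrite edge_sym.
Qed.

(** Exchange $x_j$ out of $x_ax_ix_j$ towards $x_ax_kx_l$, where [j] is a neighbour of [i]: the
    incoming variable can only be $x_k$ or $x_l$. *)
Lemma edge_exch i k l : edge k l -> i \notin T -> edge i k \/ edge i l.
Proof.
move=> kl iT; have [j ij] := edge_total iT.
have [u Bu _] := B_full i; have [a [_ [_ [aT _ _]]]] := edge_gen Bu.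
have [_ jT Bij] := edgeP ij aT; have [kT lT Bkl] := edgeP kl aT.
have [<-|njk] := eqVneq j k; first by left.
have [<-|njl] := eqVneq j l; first by right.
have ne b : b \notin T -> a == b = false.
  by move=> bT; apply/eqP => E; rewrite -E aT in bT.
have [|m lt_m Bm] := B_exch Bij Bkl (i := j).
  by rewrite !mnmDE !mnm1E ne // !(eq_sym _ j) (negPf njk) (negPf njl) eqxx addn1.
have mE : (m == k) || (m == l).
  move: lt_m; rewrite !mnmDE !mnm1E !(eq_sym _ m).
  case: (m == k) => //; case: (m == l) => //=.
  by rewrite !addn0 -addnA ltnNge leq_addr.
have mT : m \notin T by case/orP: mE => /eqP->.
suff im : edge i m by case/orP: mE => /eqP <-; [left|right].
apply: edge_intro aT iT mT _; suff <- : (U_(a) + U_(i) + U_(j) - U_(j) + U_(m)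
  = U_(a) + U_(i) + U_(m))%MM by [].
by rewrite addmK.
Qed.

End Edges.

(** * The product of a prime on [T] and the edge ideal of a graph *)

(* A loop at [i] stands for the generator [x_i ^ 2] of the edge ideal. By
   [E_exch], non-adjacency is transitive on the loopless vertices, so the graph
   is complete multipartite apart from its loops. *)
Section Graph.
Variables (n : nat) (T : {set 'I_n}) (E : rel 'I_n) (B : set 'X_{1..n}).
Hypothesis E_sym : forall i j, E i j = E j i.
Hypothesis E_out : forall i j, E i j -> i \notin T.
Hypothesis E_total : forall i, i \notin T -> exists j, E i j.
Hypothesis E_exch : forall i k l, E k l -> i \notin T -> E i k \/ E i l.
Hypothesis B_edges : forall u, B u <-> exists a i j,
  [/\ a \in T, E i j & u = (U_(a) + U_(i) + U_(j))%MM].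
Variables (a b : 'I_n).
Hypotheses (aT : a \in T) (bT : b \notin T).
Implicit Types (A : {set 'I_n}) (m p q v : 'X_{1..n}) (t : nat).

Definition edge_mon : set 'X_{1..n} := [set m | exists i j, E i j /\ m = (U_(i) + U_(j))%MM].
Definition edge_pow t := multiples (sums edge_mon t).
Definition nbhd i : {set 'I_n} := [set j | E i j]%SET.

Definition triangle : Prop := exists i j k, [/\ E i j, E i k & E j k].
Definition loopless : Prop := forall i, ~~ E i i.

Let W t := multiples (sums B t).

Lemma nbhd_out i j : j \in nbhd i -> j \notin T.
Proof. by rewrite inE E_sym; apply: E_out. Qed.

Lemma edge_sums_T t v i : sums edge_mon t v -> i \in T -> v i = 0%N.
Proof.
move=> + iT; elim: t v => [|t IH] v; first by move=> ->; rewrite mnm0E.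
move=> [_ [v' [[k [l [kl ->]]] /IH sv ->]]]; rewrite !mnmDE sv !mnm1E.
have := E_out kl; have := E_out (etrans (E_sym _ _) kl).
by case: eqP => [->|_]; [rewrite iT | case: eqP => [->|] //; rewrite iT].
Qed.

Lemma edge_pow_up t : up_closed (edge_pow t).
Proof. exact: multiples_up. Qed.

Lemma edge_pow_restr t m : edge_pow t m -> edge_pow t (restr (~: T) m).
Proof.
move=> [v sv le]; exists v => //; apply/mnm_lepP => i; rewrite restrE inE.
by have [iT|_] := boolP (i \in T); rewrite ?(edge_sums_T sv iT) //; apply/mnm_lepP.
Qed.

Lemma edge_pow_eq t m m' : (forall i, i \notin T -> m i = m' i) ->
  edge_pow t m -> edge_pow t m'.
Proof.
move=> mE /edge_pow_restr Wm; apply: (up_closed_le (@edge_pow_up t) Wm).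
by apply/mnm_lepP => i; rewrite restrE inE; case: (boolP (i \in T)) => //= /mE ->.
Qed.

Lemma edge_pow_deg t m : edge_pow t m -> (t * 2 <= degin (~: T) m)%N.
Proof.
move=> [v sv le]; rewrite -(@sums_degin _ _ _ v (~: T) 2 _ sv); last first.
  move=> _ [i [j [ij ->]]]; rewrite deginD !degin1 !inE (E_out ij).
  by rewrite E_sym in ij; rewrite (E_out ij).
by apply: degin_le => i _; apply/mnm_lepP.
Qed.

(** By [E_exch] every edge meets every neighbourhood. *)
Lemma edge_pow_nbhd t m i : i \notin T -> edge_pow t m -> (t <= degin (nbhd i) m)%N.
Proof.
move=> iT [v sv le]; rewrite -[t]muln1.
apply: leq_trans (@sums_degin_ge _ _ _ v (nbhd i) 1 _ sv) _.
  move=> _ [k [l [kl ->]]]; rewrite deginD !degin1 !inE.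
  by case: (E_exch kl iT) => ->; rewrite ?addn1 ?add1n.
by apply: degin_le => j _; apply/mnm_lepP.
Qed.

Lemma sums_star t k p : sums (vars (nbhd k)) t p ->
  sums edge_mon t (p + U_(k) *+ t)%MM.
Proof.
move=> sp; apply: (@sums_add_gen _ (vars (nbhd k)) [set U_(k)%MM]) sp _; last exact: sums_muln.
by move=> _ _ [i iN ->] ->; exists i, k; rewrite E_sym; split=> //; rewrite inE in iN.
Qed.

(** Factors from [T] and edges use disjoint variables, so both products divide [m] together and can
    be paired factor by factor. *)
Lemma powE t m : W t m <-> (t <= degin T m)%N /\ edge_pow t m.
Proof.
split=> [[v sv le]|[/degin_vars[p sp lep] [q sq leq]]].
  split.
    rewrite -[t]muln1 -(@sums_degin _ B _ v T 1 _ sv).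
      by apply: degin_le => i _; apply/mnm_lepP.
    move=> u /B_edges[c [i [j [cT ij ->]]]]; rewrite !deginD !degin1 cT.
    rewrite (negPf (E_out ij)); rewrite E_sym in ij.
    by rewrite (negPf (E_out ij)).
  apply: (up_closed_le (@edge_pow_up t) _ le) => {m le}.
  elim: t v sv => [|t IH] v; first by move=> ->; exists 0%MM; rewrite ?lepm_refl.
  move=> [_ [v' [/B_edges[c [i [j [cT ij ->]]]] /IH[w sw le] ->]]].
  exists (U_(i) + U_(j) + w)%MM; first by exists (U_(i) + U_(j))%MM, w; split=> //; exists i, j.
  by apply/mnm_lepP => l; move/mnm_lepP/(_ l): le; rewrite !mnmDE; lia.
exists (p + q)%MM.
  apply: (@sums_add_gen _ (vars T) edge_mon) sp sq => _ _ [c cT ->] [i [j [ij ->]]].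
  by apply/B_edges; exists c, i, j; rewrite addmA.
apply/mnm_lepP => l; rewrite mnmDE; have [lT|lT] := boolP (l \in T).
  by rewrite (edge_sums_T sq lT) addn0; apply/mnm_lepP.
by rewrite (sums_vars_out sp lT); apply/mnm_lepP.
Qed.

(** * Associated primes of the powers *)

Lemma pow_up t : up_closed (W t).
Proof. exact: multiples_up. Qed.

Lemma degin_T1 i : i \notin T -> degin T U_(i)%MM = 0%N.
Proof. by move=> iT; rewrite degin1 (negPf iT). Qed.

(** The witness has enough edges but is one variable from [T] short. *)
Lemma pow_ass_T t : mon_ass (W t.+1) T.
Proof.
have [c bc] := E_total bT; have cT : c \notin T by rewrite E_sym in bc; apply: E_out bc.
pose f := (U_(a) *+ t + (U_(b) + U_(c)) *+ t.+1)%MM.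
have fdeg : degin T f = t.
  by rewrite /f deginD !degin_muln deginD !degin1 aT (negPf bT) (negPf cT); lia.
exists f => m; rewrite powE deginD fdeg; split=> [[le _]|[i iT mi]].
  by apply: degin_gt0P; lia.
have le1 : (1 <= degin T m)%N by rewrite /degin (bigD1 i) //=; lia.
split; first by lia.
exists ((U_(b) + U_(c)) *+ t.+1)%MM; first by apply: sums_muln; exists b, c.
by apply/mnm_lepP => l; rewrite /f !mnmDE; lia.
Qed.

(** The witness lacks one neighbour of [i]. If [i] has a loop, its neighbourhood is the whole
    complement of [T] and total degree is counted there instead. *)
Lemma pow_ass_nbhd t i : i \notin T -> mon_ass (W t.+1) (nbhd i).
Proof.
move=> iT; have [j ij] := E_total iT; have jT : j \notin T by rewrite E_sym in ij; apply: E_out ij.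
pose f := (U_(a) *+ t.+1 + U_(i) *+ t.+1 + U_(j) *+ t)%MM.
exists f => m; rewrite powE; split=> [[_ W2]|[k kN mk]].
  apply: degin_gt0P; have [ii|ii] := boolP (E i i).
    have -> : degin (nbhd i) m = degin (~: T) m.
      apply: eq_bigl => k; rewrite !inE; apply/idP/idP => [|kT].
        by rewrite E_sym; apply: E_out.
      by rewrite E_sym; case: (E_exch ii kT).
    have := edge_pow_deg W2; rewrite !deginD !degin_muln !degin1 !inE aT iT jT; lia.
  have := edge_pow_nbhd iT W2.
  rewrite !deginD !degin_muln !degin1 !inE (negPf ii) ij.
  case ia : (E i a) => //; last by lia.
  by move: ia; rewrite E_sym => /E_out; rewrite aT.
split.
  by rewrite /f !deginD !degin_muln !degin1 aT; lia.
exists ((U_(i) + U_(j)) *+ t + (U_(i) + U_(k)))%MM.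
  rewrite -addn1; apply: sumsD; first by apply: sums_muln; exists i, j.
  by apply: sums1; exists i, k; split=> //; rewrite inE in kN.
apply/mnm_lepP => l; have : (U_(k)%MM l <= m l)%N.
  by rewrite mnm1E; case: eqP => // <-.
rewrite /f !mnmDE !mulmnE !mnmDE; nia.
Qed.

(** A monomial representing a socle element modulo the power of the edge ideal, in the variables
    outside [T]. *)
Definition edge_socle t : Prop := exists2 z, ~ edge_pow t z &
  forall l, l \notin T -> edge_pow t (z + U_(l))%MM.

(** The monomial has degree one less than needed. Any [l] is adjacent to [i] or [j]; pairing it with
    that vertex leaves the other two vertices of the triangle as an edge. *)
Lemma triangle_socle t : triangle -> edge_socle t.+2.
Proof.
move=> [i [j [k [ij ik jk]]]].
have iT := E_out ij; have jT := E_out jk.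
have kT : k \notin T by rewrite E_sym in jk; apply: E_out jk.
exists (U_(i) + U_(j) + U_(k) + (U_(i) + U_(j)) *+ t)%MM.
  move=> /edge_pow_deg; rewrite !deginD degin_muln deginD !degin1 !inE iT jT kT /=; lia.
move=> l lT; have [c [d [e [cd le uE]]]] : exists c d e,
    [/\ E c d, E l e & (U_(i) + U_(j) + U_(k) = U_(c) + U_(d) + U_(e))%MM].
  case: (E_exch ij lT) => [li|lj]; first by exists j, k, i; split=> //;
    rewrite -addmA addmC.
  by exists i, k, j; split=> //; rewrite -addmA [(U_(j) + U_(k))%MM]addmC addmA.
exists (U_(c) + U_(d) + (U_(l) + U_(e)) + (U_(i) + U_(j)) *+ t)%MM; last first.
  by rewrite uE mnm_shuffle lepm_refl.
apply: (@sumsD _ _ 2 t); last by apply: sums_muln; exists i, j.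
apply: (@sumsD _ _ 1 1); apply: sums1; first by exists c, d.
by exists l, e.
Qed.

(** An odd power of $x_i$, one short in degree: every [l] is adjacent to [i], and the remaining
    factors pair into loops. *)
Lemma loop_socle t i : E i i -> edge_socle t.+1.
Proof.
move=> ii; have iT := E_out ii; exists (U_(i) *+ t.*2.+1)%MM.
  by move=> /edge_pow_deg; rewrite degin_muln degin1 inE iT; lia.
move=> l lT; have li : E l i by case: (E_exch ii lT).
exists (U_(i) + U_(l) + (U_(i) + U_(i)) *+ t)%MM; last first.
  by apply/mnm_lepP => x; rewrite !mnmDE !mulmnE mnmDE; lia.
apply: (@sumsD _ _ 1 t); last by apply: sums_muln; exists i, i.
by apply: sums1; exists i, l; rewrite E_sym.
Qed.

Lemma socle_ass t : edge_socle t -> mon_ass (W t) (~: T).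
Proof.
move=> [z nz zs]; exists (z + U_(a) *+ t)%MM => m; rewrite powE.
split=> [[_ Wm]|[l lT ml]].
  apply: degin_gt0P; rewrite lt0n; apply/negP => /eqP m0; apply: nz.
  apply: edge_pow_eq Wm => i iT; rewrite !mnmDE mulmnE mnm1E.
  have -> : a == i = false by apply/eqP => ai; rewrite -ai aT in iT.
  by rewrite mul0n (degin_eq0 m0) ?inE // !addn0.
split; first by rewrite !deginD degin_muln degin1 aT; lia.
rewrite inE in lT; apply: (up_closed_le (@edge_pow_up t) (zs l lT)).
apply/mnm_lepP => x; have : (U_(l)%MM x <= m x)%N.
  by rewrite mnm1E; case: eqP => // <-.
rewrite !mnmDE; lia.
Qed.

(* Without loops and triangles, the graph is complete bipartite with parts
   [nbhd i] and [nbhd j]. *)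
Lemma bipartite_pow t m i j : ~ triangle -> E i j ->
  (t <= degin (nbhd i) m)%N -> (t <= degin (nbhd j) m)%N -> edge_pow t m.
Proof.
move=> ntri ij /degin_vars[p sp lep] /degin_vars[q sq leq].
have bip k l : k \in nbhd i -> l \in nbhd j -> E k l.
  rewrite !inE => ik jl; have lT : l \notin T by rewrite E_sym in jl; apply: E_out jl.
  case: (E_exch ik lT) => [li|]; last by rewrite E_sym.
  by case: ntri; exists i, j, l; split=> //; rewrite E_sym.
exists (p + q)%MM.
  apply: (@sums_add_gen _ (vars (nbhd i)) (vars (nbhd j))) sp sq.
  by move=> _ _ [k kN ->] [l lN ->]; exists k, l; split=> //; apply: bip.
apply/mnm_lepP => l; rewrite mnmDE; have [lN|lN] := boolP (l \in nbhd i).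
  rewrite (sums_vars_out sq) ?addn0; first exact/mnm_lepP.
  apply/negP => lN'; case: ntri; exists i, j, l.
  by move: lN lN'; rewrite !inE.
by rewrite (sums_vars_out sp lN); apply/mnm_lepP.
Qed.

(** Choose [k] in [m] next to [b], then [l] in [m] next to [k]; without loops they differ, so both
    divide [m] at once. *)
Lemma edge_pow1 m : loopless -> (forall i, i \notin T -> (0 < degin (nbhd i) m)%N) ->
  edge_pow 1 m.
Proof.
move=> nl mN; have [k kN mk] := degin_gt0P (mN b bT).
have [l lN ml] := degin_gt0P (mN k (nbhd_out kN)).
exists (U_(k) + U_(l))%MM; first by apply: sums1; exists k, l; rewrite inE in lN.
rewrite inE in lN; apply/mnm_lepP => x; rewrite mnmDE !mnm1E.
by case: (k =P x) => [<-|_]; case: (l =P _) => [E'|_] //;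
  [move: (nl k); rewrite -{2}E' lN | rewrite -E'].
Qed.

(** For an edge [b c] without loops, multiplying [f] by $x_b$ leaves its degree in [nbhd b]
    unchanged, and likewise for [c]; so in the bipartite case [f] would already lie in the power. *)
Lemma pow_ass_C t : loopless -> mon_ass (W t) (~: T) -> (2 <= t)%N /\ triangle.
Proof.
move=> nl [f fE]; have nf : ~ W t f.
  move=> Wf; have /fE[i _] : W t (f + 0)%MM by rewrite addm0.
  by rewrite mnm0E.
have fU l : l \notin T -> W t (f + U_(l))%MM by move=> lT; apply/fE/hits1; rewrite inE.
have fT : (t <= degin T f)%N.
  by have /powE[+ _] := fU b bT; rewrite deginD degin_T1 // addn0.
have {}nf : ~ edge_pow t f by move=> Wf; apply: nf; apply/powE.
have {}fU l : l \notin T -> edge_pow t (f + U_(l))%MM by move=> /fU/powE[].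
have tri : triangle.
  apply: contrapT => ntri; apply: nf; have [c bc] := E_total bT.
  have cT : c \notin T by rewrite E_sym in bc; apply: E_out bc.
  apply: (bipartite_pow ntri bc).
    have := edge_pow_nbhd bT (fU b bT).
    by rewrite deginD degin1 inE (negPf (nl b)) addn0.
  have := edge_pow_nbhd cT (fU c cT).
  by rewrite deginD degin1 inE (negPf (nl c)) addn0.
split=> //; case: t nf fU {fE fT} => [|[|//]] nf fU.
  by case: nf; exists 0%MM => //; apply/mnm_lepP => i; rewrite mnm0E.
have pos k : edge_pow 1 k -> exists i j, [/\ E i j, i != j & (U_(i) + U_(j) <= k)%MM].
  move=> [_ [_ [_ [[i [j [ij ->]]] -> ->]]] le]; exists i, j; split=> //.
    by apply/eqP => E'; have := nl i; rewrite {2}E' ij.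
  by rewrite addm0 in le.
have [k [l [kl nkl le]]] := pos _ (fU b bT).
(* For [t = 1]: an edge dividing $x_cf$ has distinct endpoints, so if $x_c$ already divides [f], the
   edge divides [f]. *)
have [c cT fc] : exists2 c, c \notin T & (0 < f c)%N.
  have := mnm_lepP le l; have := mnm_lepP le k; rewrite !mnmDE !mnm1E !eqxx.
  have lk : (l == k) = false by rewrite eq_sym (negPf nkl).
  rewrite (negPf nkl) lk; case: (b =P k) => [->|_].
    by rewrite (negPf nkl); exists l; [rewrite E_sym in kl; apply: E_out kl | lia].
  by exists k; [apply: E_out kl | lia].
case: nf; have [i [j [ij nij {}le]]] := pos _ (fU c cT).
exists (U_(i) + U_(j))%MM; first by apply: sums1; exists i, j.
apply/mnm_lepP => x; have := mnm_lepP le x; rewrite !mnmDE !mnm1E.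
case: (c =P x) => [<- _|_]; last by rewrite addn0.
apply: leq_trans fc; case: (i =P c) => [E1|_]; case: (j =P c) => [E2|_] //.
by rewrite E1 E2 eqxx in nij.
Qed.

Lemma pow_assP t A : mon_ass (W t.+1) A <->
  [\/ A = T, exists2 i, i \notin T & A = nbhd i |
      A = (~: T)%SET /\ mon_ass (W t.+1) (~: T)].
Proof.
split; last first.
  by move=> [->|[i iT ->]|[-> //]]; [apply: pow_ass_T | apply: pow_ass_nbhd].
move=> [f fE].
have nW m : (forall i, i \in A -> m i = 0%N) -> ~ W t.+1 (f + m)%MM.
  by move=> m0 /fE[i /m0->].
have [c bc] := E_total bT; have cT : c \notin T by rewrite E_sym in bc; apply: E_out bc.
have [i0 i0A] : exists i, i \in A.
  apply: contrapT => no; apply: (nW ((U_(a) + U_(b) + U_(c)) *+ t.+1)%MM).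
    by move=> i iA; case: no; exists i.
  exists ((U_(a) + U_(b) + U_(c)) *+ t.+1)%MM; last exact: lem_addl.
  by apply: sums_muln; apply/B_edges; exists a, b, c.
have fA i : i \in A -> W t.+1 (f + U_(i))%MM by move=> iA; apply/fE/hits1.
(* If [f] fails the degree condition on [T], only variables from [T] can repair it. *)
have [fT|fT] := ltnP (degin T f) t.+1.
  apply: Or31.
  have AT i : i \in A -> (i \in T) /\ t = degin T f.
    by move=> /fA/powE[]; rewrite deginD degin1; case: (i \in T) => //=; lia.
  have [i0T fTE] := AT _ i0A; apply/setP => i; apply/idP/idP => [/AT[]//|iT].
  apply/hits1/fE/powE; split; first by rewrite deginD degin1 iT; lia.
  have /fA/powE[_] := i0A; apply: edge_pow_eq => j jT; rewrite !mnmDE !mnm1E.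
  have ne k : k \in T -> (k == j) = false.
    by move=> kT; apply/eqP => E'; rewrite -E' kT in jT.
  by rewrite !ne.
have nf : ~ edge_pow t.+1 f.
  by move=> Wf; apply: (nW 0%MM) => [i _|]; rewrite ?mnm0E // addm0; apply/powE.
have AT i : i \in A -> i \notin T.
  move=> iA; apply/negP => iT; apply: nf; have /fA/powE[_] := iA.
  apply: edge_pow_eq => j jT; rewrite mnmDE mnm1E; case: eqP => [E'|_]; last by rewrite addn0.
  by rewrite -E' iT in jT.
have [AU|] := pselect (A = (~: T)%SET); first by apply: Or33; split; rewrite -?AU; [|exists f].
move=> neA; apply: Or32.
have [l lT lA] : exists2 l, l \notin T & l \notin A.
  apply: contrapT => no; apply: neA; apply/setP => l; rewrite inE.
  apply/idP/idP => [/AT//|lT]; apply: contrapT => lA; apply: no; exists l => //.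
  exact/negP.
exists l => //.
(* Powers of $x_l$ do not meet [A], so they may be added freely. With $x_l^{t+1}$ present, stars at
   [l] show that degree [t.+1] in [nbhd l] suffices. *)
have fl m : (t < degin (nbhd l) (f + m)%MM)%N -> W t.+1 (f + m + U_(l) *+ t.+1)%MM.
  move=> lt; apply/powE; split; first by rewrite !deginD; lia.
  have [p sp lep] := degin_vars lt; exists (p + U_(l) *+ t.+1)%MM; first exact: sums_star.
  by apply/mnm_lepP => x; have := mnm_lepP lep x; rewrite !mnmDE; lia.
have flt : (degin (nbhd l) f <= t)%N.
  rewrite leqNgt; apply/negP => lt; apply: (nW (U_(l) *+ t.+1)%MM).
    by move=> i iA; rewrite mulmnE mnm1E; case: eqP => // E'; rewrite E' iA in lA.
  by have := fl 0%MM; rewrite addm0; apply.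
have sub i : i \in A -> (i \in nbhd l) /\ degin (nbhd l) f = t.
  move=> /fA/powE[_ /(edge_pow_nbhd lT)]; rewrite deginD degin1.
  by case: (i \in nbhd l) => //=; lia.
apply/setP => i; apply/idP/idP => [/sub[]//|iN].
have [_ fN] := sub _ i0A.
have : W t.+1 (f + (U_(i) + U_(l) *+ t.+1))%MM.
  by rewrite addmA; apply: fl; rewrite deginD fN degin1 iN; lia.
move=> /fE[j jA]; rewrite mnmDE mulmnE !mnm1E.
case: (i =P j) => [->//|_]; case: eqP => // E'.
by rewrite E' jA in lA.
Qed.


(** * Depth of the powers *)

Variable K : fieldType.
Local Notation R := {mpoly K[n]}.

Lemma mcoeffXM (i : 'I_n) (p : R) m : ('X_i * p)@_(U_(i) + m) = p@_m.
Proof. by rewrite mulrC mcoeffMX. Qed.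

(** Let [s] agree with the socle monomial outside [T] and have degree [t] in [T]. The cocycle is
    $x_ix^s$ outside [T] and zero on [T]; a primitive would have coefficient 0 at [s] because of [a]
    and 1 because of [b]. *)
Lemma pow_koszul1 t : edge_socle t.+1 ->
  koszul1 (fun i => 'X_i : R) (mon_ideal (W t.+1)).
Proof.
move=> [z nz zs].
have [s sT sU] : exists2 s, degin T s = t & forall i, i \notin T -> s i = z i.
  exists (restr (~: T) z + U_(a) *+ t)%MM => [|i iT].
    rewrite deginD degin_muln degin1 aT mul1n degin_notin // => i iT.
    by rewrite restrE inE iT.
  rewrite mnmDE mulmnE restrE inE iT mnm1E; case: eqP => [E'|_] /=.
    by rewrite -E' aT in iT.
  by rewrite addn0.
have nin m : degin T m = 0%N -> ~ W t.+1 (m + s)%MM.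
  by move=> m0 /powE[]; rewrite deginD m0 sT ltnn.
have nT i : i \in T -> ~ W t.+1 (U_(i) + s)%MM.
  move=> iT /powE[_]; move/(edge_pow_eq (m' := z)) => H; apply: nz; apply: H.
  move=> j jT; rewrite mnmDE sU // mnm1E; case: eqP => // E'.
  by rewrite -E' iT in jT.
have mixed i j : i \in T -> j \notin T -> W t.+1 (U_(i) + U_(j) + s)%MM.
  move=> iT jT; apply/powE; split; first by rewrite (deginD _ _ s) sT deginD !degin1 iT; lia.
  apply: (edge_pow_eq _ (zs j jT)) => k kT.
  rewrite !mnmDE sU // !mnm1E; case: (i =P k) => [E'|_]; last by lia.
  by rewrite -E' iT in kT.
have iJ := mon_ideal_ideal K (@pow_up t.+1).
have [J0 JD JM] := iJ.
exists (fun i => if i \in T then 0 else 'X_i * 'X_[s]).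
  move=> i j; case: ifPn => jT; case: ifPn => iT.
  - by rewrite !mulr0 subr0.
  - rewrite mulr0 sub0r; apply: (idealN iJ).
    by rewrite mulrA -!mpolyXD; apply/mon_idealX/mixed.
  - rewrite mulr0 subr0 mulrA -!mpolyXD; apply/mon_idealX/mixed => //.
  - by rewrite mulrCA subrr.
move=> [v vE]; have := oner_neq0 K; apply/negP; rewrite negbK.
have /mon_idealP/(_ _ (nT _ aT)) := vE a.
rewrite aT sub0r mcoeffN mcoeffXM => /eqP; rewrite oppr_eq0 => /eqP v0.
have /mon_idealP/(_ (U_(b) + s)%MM) := vE b.
rewrite (negPf bT) mcoeffB !mcoeffXM v0 subr0 mcoeffX eqxx => H.
by apply/eqP/H/nin; rewrite degin1 (negPf bT).
Qed.

Lemma pow_koszul2 t : loopless -> ~ triangle ->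
  koszul2 (fun i => 'X_i : R) (mon_ideal (W t.+1)).
Proof.
move=> nl ntri; have [c bc] := E_total bT.
have cT : c \notin T by rewrite E_sym in bc; apply: E_out bc.
have excl i : i \in T = false -> E b i = ~~ E c i.
  move=> iT; apply/idP/idP => [bi|ci].
    by apply/negP => ci; case: ntri; exists b, c, i.
  have := E_exch bc (negbT iT); rewrite !(E_sym i) (negPf ci).
  by case.
have offT i : i \in T -> E b i = false.
  by move=> iT; apply/negP; rewrite E_sym => /E_out; rewrite iT.
have offT' i : i \in T -> E c i = false.
  by move=> iT; apply/negP; rewrite E_sym => /E_out; rewrite iT.
(* The variables split into [T], [nbhd b] and [nbhd c]. This [s] has degree exactly [t] in each, so
   [m + s] enters [W t.+1] exactly when [m] meets all three. *)
have [s [sT sb sc]] : exists s, [/\ degin T s = t, degin (nbhd b) s = t &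
    degin (nbhd c) s = t].
  exists ((U_(a) + U_(b) + U_(c)) *+ t)%MM.
  rewrite !degin_muln !deginD !degin1 !inE aT (negPf bT) (negPf cT).
  by rewrite offT // offT' // (negPf (nl b)) (negPf (nl c)) bc E_sym bc !mul1n.
have inW m : W t.+1 (m + s)%MM <->
    [/\ 0 < degin T m, 0 < degin (nbhd b) m & 0 < degin (nbhd c) m]%N.
  split=> [/powE[le Wm]|[mT mb mc]].
    have := edge_pow_nbhd bT Wm; have := edge_pow_nbhd cT Wm.
    by move: le; rewrite !(deginD _ m s) sT sb sc => *; split; lia.
  apply/powE; split; first by rewrite (deginD _ m s) sT; lia.
  by apply: (bipartite_pow ntri bc); rewrite (deginD _ m s) ?sb ?sc; lia.
have iJ := mon_ideal_ideal K (@pow_up t.+1).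
have [J0 JD JM] := iJ.
(* Any alternating function of the three classes [T], [nbhd b], [nbhd c]
   gives a cocycle; this one is not of the form [beta j - beta i]. *)
pose chi i j : R := ((i \in T) && E b j)%:R - ((j \in T) && E b i)%:R.
have cE i : E c i = (i \notin T) && ~~ E b i.
  have [iT|/negbTE iT] := boolP (i \in T); first by rewrite offT'.
  by rewrite excl // negbK.
have chiP i j k : chi j k - chi i k + chi i j = 0 \/
    W t.+1 (U_(i) + U_(j) + U_(k) + s)%MM.
  rewrite inW !deginD !degin1 !inE !cE /chi.
  move: (offT i) (offT j) (offT k).
  case: (i \in T); case: (E b i) => hi; try (by have := hi erefl);
  case: (j \in T); case: (E b j) => hj; try (by have := hj erefl);
  case: (k \in T); case: (E b k) => hk; try (by have := hk erefl);
  first [by right | by left; rewrite /= ?mulr0n ?mulr1n; ring].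
exists (fun i j => 'X_i * 'X_j * 'X_[s] * chi i j).
  move=> i j k.
  have -> : 'X_i * ('X_j * 'X_k * 'X_[s] * chi j k) - 'X_j * ('X_i * 'X_k * 'X_[s] * chi i k)
    + 'X_k * ('X_i * 'X_j * 'X_[s] * chi i j) =
    (chi j k - chi i k + chi i j) * ('X_i * 'X_j * 'X_k * 'X_[s]) by ring.
  case: (chiP i j k) => [->|Ws]; first by rewrite mul0r.
  by apply: JM; rewrite -!mpolyXD; apply/mon_idealX.
move=> [v vE].
have coef i j : ~ W t.+1 (U_(i) + U_(j) + s)%MM ->
    (chi i j)@_0%MM = (v j)@_(U_(j) + s)%MM - (v i)@_(U_(i) + s)%MM.
  move=> nW; have := vE i j; move: (chi i j) => x /mon_idealP/(_ _ nW).
  rewrite !mcoeffB -!mpolyXD [_ * x]mulrC.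
  rewrite -{1}[(U_(i) + U_(j) + s)%MM]addm0 mcoeffMX -addmA mcoeffXM.
  have -> : (U_(i) + (U_(j) + s) = U_(j) + (U_(i) + s))%MM.
    by apply/mnmP => l; rewrite !mnmDE addnCA.
  by rewrite mcoeffXM => /eqP; rewrite subr_eq0 => /eqP.
have Eac : chi a c = 1 by rewrite /chi aT bc (negPf cT) subr0.
have Eab : chi a b = 0 by rewrite /chi aT (negPf (nl b)) (negPf bT) subr0.
have Ebc : chi b c = 0 by rewrite /chi (negPf bT) (negPf cT) subr0.
have nWs i j : [|| degin T (U_(i) + U_(j))%MM == 0%N,
    degin (nbhd b) (U_(i) + U_(j))%MM == 0%N |
    degin (nbhd c) (U_(i) + U_(j))%MM == 0%N] -> ~ W t.+1 (U_(i) + U_(j) + s)%MM.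
  by move=> h /inW[]; case/or3P: h => /eqP->.
(* The differences from [coef] add up along [a], [b], [c], so [chi a c = chi a b + chi b c] would
   read 1 = 0. *)
have /coef : ~ W t.+1 (U_(a) + U_(c) + s)%MM.
  by apply: nWs; rewrite !deginD !degin1 !inE (offT' a) // (negPf (nl c)) !orbT.
have /coef : ~ W t.+1 (U_(a) + U_(b) + s)%MM.
  by apply: nWs; rewrite !deginD !degin1 !inE (offT a) // (negPf (nl b)) !orbT.
have /coef : ~ W t.+1 (U_(b) + U_(c) + s)%MM.
  by apply: nWs; rewrite !deginD !degin1 (negPf bT) (negPf cT).
rewrite Eac Eab Ebc mcoeff0 mcoeff1 eqxx => /eqP.
rewrite eq_sym subr_eq0 => /eqP-> <- /eqP; exact/negP/oner_neq0.
Qed.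

Lemma linear_sum_split i : i \notin T ->
  \sum_(j in ~: T) 'X_j = 'X_i - (- \sum_(j in ~: T | j != i) 'X_j) :> R.
Proof. by move=> iT; rewrite (bigD1 i) ?inE //= opprK. Qed.

Lemma substX_sum i : i \notin T -> let w := - \sum_(j in ~: T | j != i) 'X_j : R in
  substX i w w = w.
Proof.
move=> iT w; rewrite {2}/w rmorphN rmorph_sum /=; congr (- _).
by apply: eq_bigr => j /andP[_ ne]; apply: substXj.
Qed.

Lemma X_ne (i : 'I_n) (w : R) : w@_U_(i)%MM = 0 -> 'X_i - w != 0.
Proof.
move=> wi; apply/eqP => /(congr1 (mcoeff U_(i)%MM)).
by rewrite mcoeffB wi mcoeffX eqxx subr0 mcoeff0 => /eqP; rewrite oner_eq0.
Qed.

(** The sum is ['X_i - w] with [w] minus the other variables, solved for a variable that [V] does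
    not involve. *)
Lemma regular_linear_sum V : up_closed V -> (exists2 i, i \notin T & insensitive i V) ->
  regular_mod (\sum_(j in ~: T) 'X_j : R) (mon_ideal V).
Proof.
move=> Vup [i iT Vi]; rewrite (linear_sum_split iT).
apply: regular_mon_ideal => //; first exact: substX_sum.
apply: X_ne; rewrite mcoeffN raddf_sum /= big1 ?oppr0 // => j /andP[_ ne].
by rewrite mcoeffXU (negPf ne).
Qed.

Lemma regular_difference V i j : i != j -> up_closed V -> insensitive i V ->
  regular_mod ('X_i - 'X_j : R) (mon_ideal V).
Proof.
move=> ne Vup Vi; apply: regular_mon_ideal => //.
  by apply: substXj; rewrite eq_sym.
by apply: X_ne; rewrite mcoeffXU eq_sym (negPf ne).
Qed.

Lemma insensitive_degin t i (X : {set 'I_n}) : i \notin X ->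
  insensitive i [set m | (t <= degin X m)%N].
Proof.
move=> iX m /= le; exists (restr (~: [set i]) m).
by rewrite degin_drop // restr_drop restr_le.
Qed.

Lemma insensitive_edge_pow t i : i \in T -> insensitive i (edge_pow t).
Proof.
move=> iT m /edge_pow_restr Wm; exists (restr (~: T) m).
by rewrite restrE inE iT restr_le.
Qed.

Lemma powI t : mon_ideal (W t) = mon_ideal [set m | (t <= degin T m)%N] `&`
  mon_ideal (edge_pow t) :> set R.
Proof.
by rewrite -mon_idealI; congr mon_ideal; apply/seteqP; split=> m /powE.
Qed.

Lemma ab_ne : a != b.
Proof. by apply: contraNneq bT => <-. Qed.

(** The power of the prime on [T] is free of $x_b$ and the power of the edge ideal is free of
    $x_a$. *)
Lemma regular_ab t : regular_mod ('X_a - 'X_b : R) (mon_ideal (W t)).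
Proof.
rewrite powI; apply: regular_modI; last first.
  apply: regular_difference (ab_ne) (@edge_pow_up t) _; exact: insensitive_edge_pow.
have H : regular_mod ('X_b - 'X_a : R) (mon_ideal [set m | (t <= degin T m)%N]).
  apply: regular_difference (@up_closed_degin _ _ _) _; first by rewrite eq_sym ab_ne.
  exact: insensitive_degin.
have [_ _ JM] := mon_ideal_ideal K (@up_closed_degin _ T t).
move=> g /(JM (-1)); rewrite mulN1r -mulNr opprB; exact: H.
Qed.

Let f : R := \sum_(j in ~: T) 'X_j.

(** Regularity is checked modulo each [P i] separately, and the sum is solved for a different
    variable each time. *)
Lemma regular_linear_sum_all (P : 'I_n -> set 'X_{1..n}) :
  (forall i, i \notin T -> up_closed (P i) /\ insensitive i (P i)) ->
  regular_mod f (mon_ideal [set m | forall i, i \notin T -> P i m]).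
Proof.
move=> PP u Pu m mu i iT; have [Pup Pi] := PP i iT.
apply: (regular_linear_sum Pup (ex_intro2 _ _ i iT Pi)) mu.
by move=> k /Pu /(_ i iT).
Qed.

Lemma edge_powE t : loopless -> t = 0%N \/ ~ triangle ->
  edge_pow t.+1 = [set m | forall i, i \notin T -> (t < degin (nbhd i) m)%N].
Proof.
move=> nl tt; apply/seteqP; split=> m; first by move=> Wm i iT; apply: edge_pow_nbhd.
move=> mN; case: tt => [t0|ntri]; first by subst t; apply: edge_pow1.
have [c bc] := E_total bT.
apply: (bipartite_pow ntri bc); apply: mN => //.
by rewrite E_sym in bc; apply: E_out bc.
Qed.

(** With $A=P_T^{t+1}$ and $B=J^{t+1}$, [f] is regular modulo $A$, $B$ and $A+B$. The last gives
    $(A+(f))\cap(B+(f))\subseteq(A\cap B)+(f)$, so $x_a-x_b$ can be treated modulo each side. *)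
Lemma pow_regular_pair t : loopless -> t = 0%N \/ ~ triangle ->
  weakly_regular (mon_ideal (W t.+1)) [:: f; 'X_a - 'X_b].
Proof.
move=> nl tt; pose W1 := [set m | (t.+1 <= degin T m)%N] : set 'X_{1..n}.
have W1up : up_closed W1 by apply: up_closed_degin.
have Vup : up_closed (edge_pow t.+1) by apply: edge_pow_up.
have iA := mon_ideal_ideal K W1up; have iB := mon_ideal_ideal K Vup.
have nlN i : i \notin nbhd i by rewrite inE.
have [c bc] := E_total bT.
have cT : c \notin T by rewrite E_sym in bc; apply: E_out bc.
have cb : b != c by apply: contraTneq bc => <-.
have ac : a != c by apply: contraTneq aT => ->.
have f_reg1 : regular_mod f (mon_ideal W1).
  by apply: regular_linear_sum => //; exists b => //; apply: insensitive_degin.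
have f_reg2 : regular_mod f (mon_ideal (edge_pow t.+1)).
  rewrite edge_powE //.
  apply: (@regular_linear_sum_all (fun i => [set m | (t < degin (nbhd i) m)%N])).
  by move=> i iT; split; [apply: up_closed_degin | apply: insensitive_degin].
have f_regU : regular_mod f (mon_ideal (W1 `|` edge_pow t.+1)).
  have -> : W1 `|` edge_pow t.+1 = [set m | forall i, i \notin T ->
      (W1 `|` [set m | (t < degin (nbhd i) m)%N]) m].
    rewrite edge_powE //; apply/seteqP; split=> m.
      by move=> [?|mN] i iT; [left | right; apply: mN].
    move=> H; have [?|n1] := pselect (W1 m); first by left.
    by right => i /H[].
  apply: regular_linear_sum_all => i iT; split.
    by apply: up_closedU => //; apply: up_closed_degin.
  by move=> m [/(insensitive_degin iT)|/(insensitive_degin (nlN i))] [m' [? ? ?]];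
    exists m'; split=> //; [left | right].
split; first by rewrite powI; apply: regular_modI.
split=> //; move=> h; rewrite powI => Ih.
apply: (ideal_genI iA iB).
  move=> u p q Ap Bq E'; have /f_regU : mon_ideal (W1 `|` edge_pow t.+1) (f * u).
    by rewrite E' => m /msuppD_le; rewrite mem_cat => /orP[/Ap|/Bq]; [left | right].
  exact: mon_idealU.
have mono (J J' : set R) : J `<=` J' ->
    ideal_gen (J `|` [set f]) `<=` ideal_gen (J' `|` [set f]).
  move=> JJ'; apply: ideal_gen_sub; first exact: ideal_gen_is_ideal.
  by move=> x [/JJ'|] H; apply: sub_ideal_gen; [left | right].
split.
  have : ideal_gen (mon_ideal W1 `|` [set f]) (('X_a - 'X_b) * h).
    by apply: mono Ih => x [].
  (* [f] eliminates $x_c$, which differs from $x_a$ and $x_b$ and does not occur in [W1]. *)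
  rewrite /f (linear_sum_split cT).
  apply: regular_mon_ideal_quot => //.
  - exact: substX_sum.
  - exact: insensitive_degin.
  rewrite rmorphB /= !substXj //.
  have H : regular_mod ('X_b - 'X_a : R) (mon_ideal W1).
    apply: regular_difference => //; first by rewrite eq_sym ab_ne.
    exact: insensitive_degin.
  have [_ _ JM] := iA.
  move=> g /(JM (-1)); rewrite mulN1r -mulNr opprB; exact: H.
have : ideal_gen (mon_ideal (edge_pow t.+1) `|` [set f]) (('X_a - 'X_b) * h).
  by apply: mono Ih => x [].
(* Neither the edge ideal nor [f] involves $x_a$. *)
apply: regular_mon_idealU => //.
- by apply: substXj; rewrite eq_sym ab_ne.
- by apply: X_ne; rewrite mcoeffXU eq_sym (negPf ab_ne).
- exact: insensitive_edge_pow.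
rewrite /f rmorph_sum /=; apply: eq_bigr => j; rewrite inE => jT.
by apply: substXj; apply: contraNneq jT => ->.
Qed.

Lemma pow_proper t (s : seq R) : (forall g, g \in s -> max_ideal K n g) ->
  ~ ideal_gen (mon_ideal (W t.+1) `|` [set` s]) 1.
Proof.
have iM := mon_ideal_ideal K (@hits_up n [set: 'I_n]%SET).
move=> sM; rewrite max_idealE in sM.
have sub : ideal_gen (mon_ideal (W t.+1) `|` [set` s]) `<=`
    mon_ideal (hits [set: 'I_n]%SET).
  apply: (ideal_gen_sub iM) => g [Wg|/sM//] m /Wg/powE[le _].
  by have [|i _ mi] := @degin_gt0P _ T m; [lia | exists i].
by move=> /sub/(_ 0%MM); rewrite msupp1 mem_head => -[//|i _]; rewrite mnm0E.
Qed.

Lemma X_max i : max_ideal K n ('X_i).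
Proof. by apply: sub_ideal_gen; exists i. Qed.

Lemma max_difference i j : max_ideal K n ('X_i - 'X_j).
Proof. by apply: idealB; [apply: ideal_gen_is_ideal | apply: X_max..]. Qed.

Lemma depth_pow_socle t : edge_socle t.+1 ->
  depth (max_ideal K n) (mon_ideal (W t.+1)) = 1%N.
Proof.
move=> soc; apply: greatestP.
  exists [:: 'X_a - 'X_b].
  have sM g : g \in [:: 'X_a - 'X_b] -> max_ideal K n g.
    by rewrite inE => /eqP->; apply: max_difference.
  split=> //; split; last exact: pow_proper.
  by split=> //; apply: regular_ab.
move=> d [s [sM s_reg <-]]; apply: regular_seq_le1 sM s_reg.
  exact: (mon_ideal_ideal K (@pow_up _)).
exact: pow_koszul1.
Qed.

Lemma depth_pow_pair t : loopless -> t = 0%N \/ ~ triangle ->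
  exists s, [/\ forall g, g \in s -> max_ideal K n g,
    regular_seq (mon_ideal (W t.+1)) s & size s = 2%N].
Proof.
move=> nl tt; exists [:: f; 'X_a - 'X_b].
have sM g : g \in [:: f; 'X_a - 'X_b] -> max_ideal K n g.
  rewrite !inE => /orP[/eqP->|/eqP->]; last exact: max_difference.
  by apply: ideal_sum => [|i _]; [apply: ideal_gen_is_ideal | apply: X_max].
by split=> //; split; [apply: pow_regular_pair | apply: pow_proper].
Qed.

Lemma depth_pow_bipartite t : loopless -> ~ triangle ->
  depth (max_ideal K n) (mon_ideal (W t.+1)) = 2%N.
Proof.
move=> nl ntri; apply: greatestP; first by apply: depth_pow_pair => //; right.
move=> d [s [sM s_reg <-]]; apply: regular_seq_le2 sM s_reg.
  exact: (mon_ideal_ideal K (@pow_up _)).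
exact: pow_koszul2.
Qed.

(** A regular pair excludes maximal length 1; this separates the first power from those with a
    socle. *)
Lemma depth_1_neq1 : loopless ->
  depth (max_ideal K n) (mon_ideal (W 1)) <> 1%N.
Proof.
move=> nl; have [|s Hs] := @depth_pow_pair 0 nl; first by left.
move=> d1; have := @greatest_max [set d | exists s, [/\ forall g, g \in s ->
  max_ideal K n g, regular_seq (mon_ideal (W 1)) s & size s = d]] 2.
rewrite -/(depth _ _) d1 => /(_ isT); have H : (2 <= 1)%N -> False by [].
by move=> H2; apply/H/H2; exists s.
Qed.

(** * Comparison of the two stability indices *)

Lemma Ass_powE t : Ass (mon_ideal (W t.+1) : set R) =
  [set P | exists2 A, P = mon_ideal (hits A) & mon_ass (W t.+1) A].
Proof. by apply/seteqP; split=> P; move/(AssP _ (@pow_up _)). Qed.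

Lemma loop_nbhd i : E i i -> nbhd i = (~: T)%SET.
Proof.
move=> ii; apply/setP => j; rewrite !inE; apply/idP/idP.
  by rewrite E_sym; apply: E_out.
by move=> jT; rewrite E_sym; case: (E_exch ii jT).
Qed.

(** By [pow_assP], only the prime on the complement of [T] can distinguish two positive powers. *)
Lemma Ass_pow_eq r t : (mon_ass (W r.+1) (~: T) <-> mon_ass (W t.+1) (~: T)) ->
  Ass (mon_ideal (W r.+1) : set R) = Ass (mon_ideal (W t.+1)).
Proof.
move=> [rt tr]; rewrite !Ass_powE; apply/seteqP.
by split=> P [A -> /pow_assP[?|?|[? ?]]]; exists A => //; apply/pow_assP;
  [apply: Or31 | apply: Or32 | apply: Or33; split; auto
  | apply: Or31 | apply: Or32 | apply: Or33; split; auto].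
Qed.

Lemma astab_eq_dstab_edges :
  stab_index (fun t => Ass (mon_ideal (W t) : set R)) =
  stab_index (fun t => depth (max_ideal K n) (mon_ideal (W t))).
Proof.
have const1 : (forall t, mon_ass (W t.+1) (~: T) <-> mon_ass (W 1) (~: T)) ->
    stab_index (fun t => Ass (mon_ideal (W t) : set R)) = 1%N.
  move=> H; apply: stab_index_eq1 => -[//|t] _.
  exact: Ass_pow_eq.
have [[i ii]|noloop] := pselect (exists i, E i i).
  have iT := E_out ii; rewrite const1 => [|t].
    apply/esym/stab_index_eq1 => -[//|t] _.
    by rewrite !depth_pow_socle //; apply: loop_socle ii.
  (* With a loop the complement of [T] is a neighbourhood, hence associated to every positive
     power. *)
  by rewrite -(loop_nbhd ii); split=> _; apply: pow_ass_nbhd.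
have nl : loopless by move=> i; apply/negP => ii; apply: noloop; exists i.
have [tri|ntri] := pselect triangle; last first.
  rewrite const1 => [|t]; last by split=> /(pow_ass_C nl)[].
  by apply/esym/stab_index_eq1 => -[//|t] _; rewrite !depth_pow_bipartite.
(* A triangle without loops: the complement of [T] appears exactly from the second power on. *)
have C2 t : mon_ass (W t.+2) (~: T) by apply/socle_ass/triangle_socle.
have nC1 : ~ mon_ass (W 1) (~: T) by move=> /(pow_ass_C nl)[].
rewrite stab_index_eq2; last first.
- move=> AE; have : Ass (mon_ideal (W 2) : set R) (mon_ideal (hits (~: T))).
    by rewrite Ass_powE; exists (~: T)%SET.
  by rewrite -AE Ass_powE => -[A /hits_mon_inj <-].
- move=> [|[|t]] // _; exact: Ass_pow_eq.
apply/esym/stab_index_eq2 => [[|[|t]] // _|].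
  by rewrite !depth_pow_socle //; apply: triangle_socle.
by rewrite [X in _ <> X]depth_pow_socle; [apply: depth_1_neq1 | apply: triangle_socle].
Qed.

End Graph.

(** * From polymatroidal ideals to separators *)

Section Polymatroidal.
Variables (K : fieldType) (n d : nat) (I : set {mpoly K[n]}).
Hypothesis I_poly : polymatroidal d I.
Let B : set 'X_{1..n} := mingens I.
Let W t := multiples (sums B t).

Lemma polymatroidal_deg u : B u -> mdeg u = d.
Proof.
have [[A IE Adeg] _] := I_poly; rewrite /B IE => /mingens_least; exact: Adeg.
Qed.

Lemma polymatroidal_gen : I = monomial_gen B.
Proof. by have [[A IE _] _] := I_poly; rewrite /B IE mingens_gen. Qed.

(** The exchanged monomial lies in [I] and has degree [d], so a generator dividing it equals it. *)
Lemma polymatroidal_exchange : exchange B.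
Proof.
move=> u v Bu Bv i lt_i; have [_ Iex] := I_poly.
have [j lt_j Ij] := Iex u v Bu Bv i lt_i; exists j => //.
move: Ij; rewrite {1}polymatroidal_gen => /monomial_gen_dvd[w Bw le].
suff <- : w = (u - U_(i) + U_(j))%MM by [].
have ui : (0 < u i)%N by lia.
have Edeg := degin_exchange [set: 'I_n]%SET j ui.
rewrite !deginT !inE !addn1 (polymatroidal_deg Bu) in Edeg; case: Edeg => Edeg.
have := mdegD ((u - U_(i) + U_(j)) - w)%MM w; rewrite submK // Edeg.
rewrite (polymatroidal_deg Bw) => /eqP; rewrite -[X in X == _]add0n eqn_add2r.
rewrite eq_sym mdeg_eq0 => /eqP E; by rewrite -[RHS](submK le) E add0m.
Qed.

Lemma polymatroidal_pow t : ideal_pow I t = mon_ideal (W t).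
Proof. by rewrite {1}polymatroidal_gen ideal_pow_monomial. Qed.

Lemma max_ideal_Ass_infty t0 : (0 < t0)%N ->
  (forall t A, (t0 <= t)%N -> mon_ass (W t) A <-> mon_ass (W t0) A) ->
  mon_ass (W t0) [set: 'I_n]%SET -> Ass_infty I (max_ideal K n).
Proof.
move=> t0_gt0 stable mW; rewrite /Ass_infty /astab.
rewrite (@stab_indexE _ (fun t => Ass (ideal_pow I t)) t0 _ _ t0) //.
  rewrite polymatroidal_pow max_idealE; apply/AssP; first exact: multiples_up.
  by exists [set: 'I_n]%SET.
move=> t le; rewrite !polymatroidal_pow; apply/seteqP.
by split=> P /(AssP _ (@multiples_up _ _))[A -> HA]; apply/(AssP _ (@multiples_up _ _));
  exists A => //; have := stable t A le; case; auto.
Qed.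

Hypothesis I_full : full_supported I.

(** A connected exchange graph on all variables would make the maximal ideal stably associated;
    otherwise a proper closed set separates the generators. *)
Lemma separator_of_not_Ass : ~ Ass_infty I (max_ideal K n) -> (0 < d)%N ->
  exists T i j, [/\ separator B T, i \in T & j \notin T].
Proof.
move=> nAss d_gt0.
have [B_ne|B0] := pselect (exists u, B u); last first.
  (* Without generators, full support leaves no variables; the maximal ideal is then zero and
     associated to every positive power. *)
  case: nAss; have W0 t m : ~ W t.+1 m by move=> [_ [u [_ [Bu _ _]]] _]; apply: B0; exists u.
  have WE t : W t.+1 = W 1 by apply/seteqP; split=> m /W0.
  apply: (@max_ideal_Ass_infty 1) => // [[//|t] A _|]; first by rewrite WE.
  exists 0%MM => m; split=> [/W0//|[i _ _]].
  by have [u Bu _] := I_full i; case: B0; exists u.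
have [u Bu] := B_ne; have [i _ ui] : exists2 i, i \in [set: 'I_n]%SET & (0 < u i)%N.
  by apply: degin_gt0P; rewrite deginT (polymatroidal_deg Bu).
have mu : minimal_in B [set: 'I_n]%SET u by rewrite (minimal_in_setT polymatroidal_deg).
have iT : i \in [set: 'I_n]%SET by rewrite inE.
have [[t0 aW]|[T [_ neT iT' Tcl]]] :=
    connected_or_closed iT mu ui.
  have [s0 s0_gt0 stable] := mon_ass_all_stable polymatroidal_exchange B_ne.
  case: nAss; apply: (max_ideal_Ass_infty s0_gt0 stable).
  by apply/(stable (maxn s0 t0)); [apply: leq_maxl | apply/aW/leq_maxr].
have [j _ jT] : exists2 j, j \in [set: 'I_n]%SET & j \notin T.
  by apply/fintype.subsetPn; apply: contra neT => sub; rewrite finset.eqEsubset sub finset.subsetT.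
exists T, i, j; split=> //.
exact: (closed_in_separator polymatroidal_deg polymatroidal_exchange Tcl).
Qed.

End Polymatroidal.

Lemma astab_eq_dstab_separator (K : fieldType) (n : nat) (I : set {mpoly K[n]})
    (T : {set 'I_n}) a b :
  polymatroidal 3 I -> full_supported I -> separator (mingens I) T ->
  (forall u, mingens I u -> degin T u = 1%N) -> a \in T -> b \notin T ->
  astab I = dstab I.
Proof.
move=> I_poly I_full sep degT aT bT.
have deg := polymatroidal_deg I_poly; have Bex := polymatroidal_exchange I_poly.
have IE : ideal_pow I = fun t => mon_ideal (multiples (sums (mingens I) t)).
  by apply/funext => t; apply: polymatroidal_pow I_poly t.
rewrite /astab /dstab IE.
apply: (@astab_eq_dstab_edges n T (edge (mingens I) T) _ _ _ _ _ _ a b aT bT K).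
- exact: edge_sym.
- by move=> i j /and3P[].
- exact: edge_total deg I_full sep degT.
- exact: edge_exch Bex deg I_full sep degT.
move=> u; split=> [Bu|[c [i [j [cT ij ->]]]]].
  exact: (edge_gen deg I_full sep degT Bu).
by have [] := edgeP ij cT.
Qed.

Theorem proposition2p14 (K : fieldType) (n : nat) (I : set {mpoly K[n]})
    (I_polymatroidal : polymatroidal 3 I)
    (I_full_supported : full_supported I)
    (gcd_I : is_mgcd (mingens I) 0%MM)
    (m_notin_Ass : ~ Ass_infty I (max_ideal K n)) :
  astab I = dstab I.
Proof.
have [T [i [j [sep iT jT]]]] :=
  separator_of_not_Ass I_polymatroidal I_full_supported m_notin_Ass isT.
have deg := polymatroidal_deg I_polymatroidal.
have Bdeg u v := @separator_degin _ _ _ deg T u v sep.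
have [u Bu ui] := I_full_supported i; have [v Bv vj] := I_full_supported j.
have uT : (0 < degin T u)%N by rewrite /degin (bigD1 i) //=; lia.
have vT : (0 < degin (~: T) v)%N by rewrite /degin (bigD1 j) ?inE //=; lia.
have uvT := Bdeg u v Bu Bv; have := degin_setC T v; rewrite (deg v Bv) => v3.
(* The constant degree in [T] is 1 or 2, since generators meet both [T] and its complement; if it is
   2, the two sets change roles. *)
have [T1|T1] := eqVneq (degin T v) 1%N.
  apply: astab_eq_dstab_separator sep _ iT jT => // w Bw.
  by rewrite (Bdeg w v).
apply: (@astab_eq_dstab_separator K n I (~: T) j i) => //; rewrite ?inE ?negbK //.
  exact: separatorC.
move=> w Bw; have := degin_setC T w; rewrite (deg w Bw) (Bdeg w v Bw Bv).
move: T1 => /eqP; lia.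
Qed.
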